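(* Let $n\ge 3$ be an integer, let $K$ be a field containing $n$ distinct $n$-th roots of $1$, let $R=K[x,y,z]$, and let $I=(x(y^n-z^n),\,y(z^n-x^n),\,z(x^n-y^n))$. Then the Castelnuovo-Mumford regularity of the symbolic powers of $I$ satisfies $$\mathrm{reg}(I^{(m)})=m(n+1)\quad\text{for all } m\gg 0,$$ i.e. there is an integer $m_0$ such that the equality holds for all $m\ge m_0$.
   Context: $I^{(m)}$ denotes the $m$-th symbolic power, $I^{(m)}=\bigcap_{\mathfrak p\in \mathrm{Ass}(R/I)}(I^mR_{\mathfrak p}\cap R)$; for this ideal it is equivalently $(x^n-y^n,y^n-z^n)^m\cap(x,y)^m\cap(y,z)^m\cap(z,x)^m$. $\mathrm{reg}$ is the Castelnuovo-Mumford regularity: $\mathrm{reg}(M)=\max\{j-p:\beta_{p,j}(M)\neq 0\}$, where $\beta_{p,j}$ are the graded Betti numbers over the standard graded ring $R$. *)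

(* Defs.v *)
From HB Require Import structures.
From mathcomp Require Import all_boot all_order all_algebra.
From mathcomp Require Import mpoly.

Set Implicit Arguments.
Unset Strict Implicit.
Unset Printing Implicit Defensive.

Import Order.TTheory GRing.Theory Num.Theory.
Local Open Scope ring_scope.

(* Ideals are Prop-valued predicates rather than the boolean {pred R} of      *)
(* ring_quotient: neither ideal membership nor primality is decidable here.   *)

Section Ideals.
Variable R : comNzRingType.
Implicit Types (S I P : R -> Prop).

Definition ideal_gen S : R -> Prop := fun f =>
  exists s : seq (R * R),
    (forall c, c \in s -> S c.2) /\ f = \sum_(c <- s) c.1 * c.2.

Definition ideal_pow I (m : nat) : R -> Prop :=
  ideal_gen (fun f => exists t : 'I_m -> R,
    (forall i, I (t i)) /\ f = \prod_(i < m) t i).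

Definition is_ideal I : Prop :=
  [/\ I 0, forall f g, I f -> I g -> I (f + g)
    & forall a f, I f -> I (a * f)].

Definition is_prime P : Prop :=
  [/\ is_ideal P, ~ P 1 & forall f g, P (f * g) -> P f \/ P g].

(* P \in Ass(R/I): P is prime and is the annihilator of the class of some f. *)
Definition is_associated_prime I P : Prop :=
  is_prime P /\ exists f, forall g, P g <-> I (g * f).

End Ideals.

Section SymbolicPowers.
Variable R : idomainType.
Implicit Types (I P : R -> Prop).
Local Notation "x %:F" := (@FracField.tofrac R x).

(* R_P and I R_P, as subsets of the field of fractions of the domain R. *)
Definition localization P : {fraction R} -> Prop := fun u =>
  exists a s : R, ~ P s /\ u = a%:F / s%:F.

Definition extended_ideal I P : {fraction R} -> Prop := fun u =>
  exists s : seq (R * {fraction R}),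
    (forall c, c \in s -> I c.1 /\ localization P c.2)
    /\ u = \sum_(c <- s) c.1%:F * c.2.

Definition symbolic_power I (m : nat) : R -> Prop := fun f =>
  forall P, is_associated_prime I P -> extended_ideal (ideal_pow I m) P f%:F.

End SymbolicPowers.

Section Regularity.
Variables (k : nat) (K : fieldType).
Local Notation R := {mpoly K[k]}.
Implicit Types (J : R -> Prop).

(* A list of shifts a encodes the graded free module \bigoplus_i R(-a_i),     *)
(* whose i-th basis vector has degree a_i. Elements are row vectors, maps act *)
(* by right multiplication. The matrix A : F(a) -> F(b) preserves degrees iff *)
(* A i j is homogeneous of degree a_i - b_j (hence 0 if a_i < b_j).           *)
Definition graded_mx (a b : seq int) (A : 'M[R]_(size a, size b)) : Prop :=
  forall i j (u : 'X_{1..k}), u \in msupp (A i j) -> (mdeg u)%:Z = a`_i - b`_j.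

Record min_graded_free_resolution J := MinGradedFreeResolution {
  shifts : nat -> seq int;
  augmentation : 'M[R]_(size (shifts 0), size [:: 0 : int]);
  differential : forall p, 'M[R]_(size (shifts p.+1), size (shifts p));
  augmentation_graded : graded_mx augmentation;
  differential_graded : forall p, graded_mx (differential p);
  augmentation_image : forall f : R,
    J f <-> exists v : 'rV_(size (shifts 0)), f = (v *m augmentation) 0 0;
  augmentation_exact : forall v : 'rV_(size (shifts 0)),
    v *m augmentation = 0 <-> exists w, v = w *m differential 0;
  differential_exact : forall p (v : 'rV_(size (shifts p.+1))),
    v *m differential p = 0 <-> exists w, v = w *m differential p.+1;
  (* minimality: all entries lie in the ideal generated by the variables *)
  differential_minimal : forall p i j, (differential p i j)@_0%MM = 0
}.

Definition graded_betti J (F : min_graded_free_resolution J) (p : nat)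
  (j : int) : nat := count_mem j (shifts F p).

(* reg J = r. The minimal graded free resolution of a homogeneous ideal       *)
(* exists and is unique up to isomorphism, so that the choice of F is         *)
(* immaterial; the existence of the maximum is part of the assertion.         *)
Definition has_regularity J (r : int) : Prop :=
  exists F : min_graded_free_resolution J,
    (exists p j, graded_betti F p j != 0%N /\ j - p%:Z = r)
    /\ (forall p j, graded_betti F p j != 0%N -> j - p%:Z <= r).

End Regularity.

Definition fermat_ideal (K : fieldType) (n : nat) : {mpoly K[3]} -> Prop :=
  let x : {mpoly K[3]} := 'X_(@Ordinal 3 0 isT) in
  let y : {mpoly K[3]} := 'X_(@Ordinal 3 1 isT) in
  let z : {mpoly K[3]} := 'X_(@Ordinal 3 2 isT) in
  ideal_gen (fun f => f \in [:: x * (y ^+ n - z ^+ n);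
                                y * (z ^+ n - x ^+ n);
                                z * (x ^+ n - y ^+ n)]).

Arguments fermat_ideal K n : clear implicits.

(* Main.v *)
(* Each of the 3n lines x = eps y, y = eps z, z = eps x contains n + 1 of the *)
(* n^2 + 3 points defined by I, so by Bezout a form of degree < m(n+1) in     *)
(* J = I^(m) vanishes on all of them. As J contains forms that do not, it     *)
(* needs a generator of degree >= m(n+1).                                     *)
(*                                                                            *)
(* For the upper bound, g = x^n + y^n - z^n vanishes at none of the points    *)
(* and is therefore regular on R/J, over any field. A linear form with this   *)
(* property need not exist over a small field, but g serves equally well:     *)
(* writing g in (x,y,z) gives a homotopy on the Koszul complex of R/J, so     *)
(* that reg J <= m(n+1) follows once J + (g) contains all forms of degree     *)
(* m(n+1) + n - 1. Over K[x^n,y^n,z^n] the points become the four points      *)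
(* [1:1:1], [1:0:0], [0:1:0], [0:0:1], and products of conics through these   *)
(* and of lines through the first one restrict to all monomials modulo g.     *)
(* The minimal resolution is built by lifting the vanishing of Koszul         *)
(* homology from a module to its successive syzygies.                         *)

Require Import Defs.
From HB Require Import structures.
From mathcomp Require Import all_boot all_order all_algebra.
From mathcomp Require Import cyclic.
From mathcomp Require Import mpoly ssrcomplements ring zify.
From Stdlib Require Import Classical ClassicalEpsilon.

Set Implicit Arguments.
Unset Strict Implicit.
Unset Printing Implicit Defensive.

Import Order.TTheory GRing.Theory Num.Theory.
Local Open Scope ring_scope.

(** * Monomial maps and Koszul complexes *)

(** Lower bound. One line suffices: y = z contains the points [1:tau:tau] with tau = 0 or tau^n = 1,
    which are n + 1 points defined by I. A form in I^(m) restricts to a polynomial in one variable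
    divisible by the m-th powers of n + 1 distinct linear factors, so in degree below m(n+1) its
    restriction is 0 ([line_vanishes]). But (y(z^n - x^n))^m lies in I^(m) and has nonzero
    restriction, so some generator has degree at least m(n+1) ([not_generated_below]).

    Upper bound. Regularity is controlled by vanishing of Koszul homology on x, y, z
    ([koszul_regular]). This vanishing passes to syzygies with the bound raised by one
    ([koszul_regular_ker]), so [regular_resolution] builds a minimal resolution whose p-th shifts
    are at most r + p. For an ideal J the vanishing follows from [koszul_regular_criterion], applied
    to g = x^n + y^n - z^n: g must be regular modulo J, and J + (g) must contain everything of order
    at least m(n+1) + n - 1.

    Regularity of g is local at the associated primes of I. As I is saturated ([fermat_saturated]),
    such a prime omits one of x, y, z; it is then of one of four kinds ([fermat_primeP]), none of
    which contains g. The second condition ([symbolic_onto]) comes from the explicit elements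
    [fat_point_elt]; the choice of their exponents in [fat_point_exponents] is where m >= n enters.
    The symbolic power is graded by [graded_local], which does not assume the primes homogeneous. *)

Section MonomialMaps.
Variables (k : nat) (K : fieldType) (V : lmodType K).
Implicit Types (f g : {mpoly K[k]}) (u : 'X_{1..k}).

Definition mlin (phi : 'X_{1..k} -> V) f : V :=
  \sum_(u <- msupp f) f@_u *: phi u.

Lemma mlinwE phi f N : (msize f <= N)%N ->
  mlin phi f = \sum_(u : 'X_{1..k < N}) f@_u *: phi u.
Proof.
move=> le_fN; pose I : subFinType _ := 'X_{1..k < N}.
rewrite /mlin (big_mksub I) ?msupp_uniq //=; last first.
  by move=> u /msize_mdeg_lt /leq_trans; apply.
by rewrite big_rmcond //= => u /memN_msupp_eq0 ->; rewrite scale0r.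
Qed.

Lemma mlin_is_linear phi : linear (mlin phi).
Proof.
move=> c f g; pose N := maxn (msize (c *: f + g)) (maxn (msize f) (msize g)).
rewrite !(@mlinwE _ _ N) ?leq_max ?leqnn ?orbT // scaler_sumr -big_split /=.
by apply: eq_bigr => u _; rewrite mcoeffD mcoeffZ scalerDl scalerA.
Qed.

HB.instance Definition _ phi :=
  GRing.isLinear.Build K {mpoly K[k]} V _ (mlin phi) (mlin_is_linear phi).

Lemma mlinX phi u : mlin phi 'X_[u] = phi u.
Proof. by rewrite /mlin msuppX big_seq1 mcoeffX eqxx scale1r. Qed.

End MonomialMaps.

Lemma mlin_comp k (K : fieldType) (phi psi : 'X_{1..k} -> {mpoly K[k]}) f :
  mlin phi (mlin psi f) = mlin (fun u => mlin phi (psi u)) f.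
Proof.
rewrite [mlin psi f]/mlin linear_sum; apply: eq_bigr => u _.
by rewrite linearZ.
Qed.

Lemma mcoeff_mlin k (K : fieldType) (phi : 'X_{1..k} -> {mpoly K[k]}) f w :
  (mlin phi f)@_w = \sum_(u <- msupp f) f@_u * (phi u)@_w.
Proof.
by rewrite /mlin raddf_sum /=; apply: eq_bigr => u _; rewrite mcoeffZ.
Qed.

Section DivideByVariable.
Variables (k : nat) (K : fieldType).
Local Notation R := {mpoly K[k]}.
Implicit Types (f g : R) (u : 'X_{1..k}) (i j : 'I_k).

(** Monomials free of the variable go to 0, so this is a total linear left inverse of multiplication
    by ['X_i]. It makes all Koszul preimages below explicit. *)
Definition divX i : R -> R :=
  mlin (fun u => if u i == 0%N then 0 else 'X_[u - U_(i)] : R).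

HB.instance Definition _ i := GRing.Linear.on (divX i).

Lemma divX_mon i u :
  divX i 'X_[u] = if u i == 0%N then 0 else 'X_[u - U_(i)].
Proof. exact: mlinX. Qed.

Lemma divXK i f : divX i ('X_i * f) = f.
Proof.
elim/mpolyind: f => [|c u f _ _ IH]; first by rewrite mulr0 linear0.
rewrite mulrDr linearD /= IH -scalerAr linearZ /= -mpolyXD divX_mon.
by rewrite mnmDE mnm1E eqxx addmC addmK.
Qed.

Lemma divXM i j f : i != j -> divX i ('X_j * f) = 'X_j * divX i f.
Proof.
move=> ne_ij.
elim/mpolyind: f => [|c u f _ _ IH]; first by rewrite mulr0 !linear0 mulr0.
rewrite mulrDr !linearD /= IH mulrDr -scalerAr !linearZ /= -scalerAr.
congr (c *: _ + _); rewrite -mpolyXD !divX_mon mnmDE mnm1E.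
rewrite [j == i]eq_sym (negbTE ne_ij) add0n.
case: eqP => [_|/eqP ui]; first by rewrite mulr0.
by rewrite -mpolyXD addmBA // lep1mP.
Qed.

Lemma divXE i f :
  f - 'X_i * divX i f = mlin (fun u => if u i == 0%N then 'X_[u] else 0 : R) f.
Proof.
elim/mpolyind: f => [|c u f _ _ IH]; first by rewrite !linear0 mulr0 subr0.
rewrite [RHS]linearD linearZ /= mlinX -IH linearD linearZ /= divX_mon.
rewrite mulrDr opprD addrACA; congr (_ + _); rewrite -scalerAr -scalerBr.
congr (_ *: _).
case: eqP => [_|/eqP ui]; first by rewrite mulr0 subr0.
by rewrite -mpolyXD addmC submK ?lep1mP // subrr.
Qed.

Lemma mdeg_divX i f u : u \in msupp (divX i f) ->
  exists2 v, v \in msupp f & mdeg v = (mdeg u).+1.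
Proof.
rewrite mcoeff_msupp mcoeff_mlin.
case: (boolP (has (fun v => mdeg v == (mdeg u).+1) (msupp f))).
  by case/hasP => v vf /eqP dv _; exists v.
move/hasPn => H /eqP[]; rewrite big_seq big1 // => v vf.
case: eqP => [_|/eqP vi]; first by rewrite mcoeff0 mulr0.
rewrite mcoeffX; case: eqP => [e|_]; last by rewrite mulr0.
case/negP: (H _ vf); rewrite -e -[v in X in X == _](@submK _ U_(i)) ?lep1mP //.
by rewrite mdegD mdeg1 addn1.
Qed.

End DivideByVariable.

Section RowIdentities.
Variables (R : comNzRingType) (q : nat).
Implicit Types (x y z : R) (n w v : 'rV[R]_q).

Lemma koszul_boundary_row x y z n1 n2 w1 w2 :
  y *: (n1 + x *: w2) + z *: (n2 - x *: w1) =
  x *: (y *: w2 - z *: w1) + y *: n1 + z *: n2.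
Proof. by apply/rowP => j; rewrite !mxE; ring. Qed.

Lemma koszul_shift_row x y z v0 v1 v2 u0 u1 u2 :
  x *: (v0 - (y *: u2 - z *: u1)) + y *: (v1 - (z *: u0 - x *: u2)) +
  z *: (v2 - (x *: u1 - y *: u0)) = x *: v0 + y *: v1 + z *: v2.
Proof. by apply/rowP => j; rewrite !mxE; ring. Qed.

Lemma koszul_shift2_row y z w1 w2 u :
  y *: (w2 - z *: u) - z *: (w1 - y *: u) = y *: w2 - z *: w1.
Proof. by apply/rowP => j; rewrite !mxE; ring. Qed.

Lemma rowBZ x v w j : (v - x *: w) 0 j = v 0 j - x * w 0 j.
Proof. by rewrite !mxE. Qed.

Lemma rowZ3 x y z n w v j :
  (x *: n + y *: w + z *: v) 0 j = x * n 0 j + y * w 0 j + z * v 0 j.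
Proof. by rewrite !mxE. Qed.

Lemma add3_peel (f a b c : R) : f = a + b + c + (f - a - b - c).
Proof. by ring. Qed.

Definition is_submodule (N : 'rV[R]_q -> Prop) : Prop :=
  [/\ N 0, forall v w, N v -> N w -> N (v + w) & forall c v, N v -> N (c *: v)].

End RowIdentities.

(** * The Koszul complex on x, y, z, with degree bounds *)

Section KoszulComplex.
Variable K : fieldType.
Local Notation R := {mpoly K[3]}.
Local Notation i0 := (@Ordinal 3 0 isT).
Local Notation i1 := (@Ordinal 3 1 isT).
Local Notation i2 := (@Ordinal 3 2 isT).
Local Notation x := ('X_i0 : R).
Local Notation y := ('X_i1 : R).
Local Notation z := ('X_i2 : R).

Lemma mdeg3E (u : 'X_{1..3}) : mdeg u = (u i0 + u i1 + u i2)%N.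
Proof.
rewrite mdegE !big_ord_recl big_ord0 addn0 addnA.
by congr (u _ + u _ + u _)%N; apply: val_inj.
Qed.

(** Each division leaves a remainder free of the variable in question, so after all three only the
    constant term is left. *)
Lemma mpoly3_split (f : R) :
  let f1 := f - x * divX i0 f in let f2 := f1 - y * divX i1 f1 in
  f = x * divX i0 f + y * divX i1 f1 + z * divX i2 f2 + (f@_0)%:MP.
Proof.
move=> f1 f2; suff e : f2 - z * divX i2 f2 = (f@_0)%:MP.
  by rewrite -e; apply: add3_peel.
rewrite {}/f2 {}/f1; elim/mpolyind: f => [|c u f _ _ IH].
  by rewrite mcoeff0 !(linear0, mulr0, subr0).
rewrite !divXE in IH *; rewrite !linearD /= IH mpolyCD. 
congr (_ + _); rewrite linearZ /= mlinX mcoeffZ mcoeffX.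
have u0E : (u == 0%MM) = [&& u i0 == 0%N, u i1 == 0%N & u i2 == 0%N].
  by rewrite -mdeg_eq0 mdeg3E !addn_eq0 andbA.
rewrite u0E; case E0: (u i0 == 0%N); last first.
  by rewrite scaler0 !linear0 mulr0 rmorph0.
rewrite linearZ /= mlinX; case E1: (u i1 == 0%N); last first.
  by rewrite scaler0 !linear0 mulr0 rmorph0.
rewrite linearZ /= mlinX; case E2: (u i2 == 0%N); last first.
  by rewrite scaler0 mulr0 rmorph0.
have /eqP-> : u == 0%MM by rewrite u0E E0 E1 E2.
by rewrite mulr1 mpolyX0 alg_mpolyC.
Qed.

Section RowVectors.
Variable q : nat.
Implicit Types (v w : 'rV[R]_q) (i j : 'I_3).

Definition divXr i : 'rV[R]_q -> 'rV[R]_q := map_mx (divX i).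

Lemma divXrD i v w : divXr i (v + w) = divXr i v + divXr i w.
Proof. by apply/rowP => j; rewrite !mxE linearD. Qed.

Lemma divXrN i v : divXr i (- v) = - divXr i v.
Proof. by apply/rowP => j; rewrite !mxE linearN. Qed.

Lemma divXr0 i : divXr i 0 = 0.
Proof. by apply/rowP => j; rewrite !mxE linear0. Qed.

Lemma divXrK i v : divXr i ('X_i *: v) = v.
Proof. by apply/rowP => j; rewrite !mxE divXK. Qed.

Lemma divXrM i j v : i != j -> divXr i ('X_j *: v) = 'X_j *: divXr i v.
Proof. by move=> ne; apply/rowP => h; rewrite !mxE divXM. Qed.

Lemma scaleX_inj i v : 'X_i *: v = 0 -> v = 0.
Proof. by move/(congr1 (divXr i)); rewrite divXrK divXr0. Qed.

Lemma divXrE i v h : divXr i v 0 h = divX i (v 0 h).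
Proof. by rewrite mxE. Qed.

Lemma row_split v v' v'' : (forall h, (v 0 h)@_0 = 0) ->
    v' = v - x *: divXr i0 v -> v'' = v' - y *: divXr i1 v' ->
  v = x *: divXr i0 v + y *: divXr i1 v' + z *: divXr i2 v''.
Proof.
move=> v0 v'E v''E; apply/rowP => h.
have e' : v' 0 h = v 0 h - x * divX i0 (v 0 h) by rewrite v'E rowBZ divXrE.
have e'' : v'' 0 h = v' 0 h - y * divX i1 (v' 0 h) by rewrite v''E rowBZ divXrE.
by rewrite [LHS]mpoly3_split v0 mpolyC0 addr0 /= -e' -e'' rowZ3 !divXrE.
Qed.

Lemma coprime_vars i j v w : i != j -> 'X_i *: v = - ('X_j *: w) ->
  v = 'X_j *: - divXr i w /\ w = - ('X_i *: - divXr i w).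
Proof.
move=> ne e; have vE : v = 'X_j *: - divXr i w.
  by rewrite -(divXrK i v) e divXrN divXrM // scalerN.
split=> //; rewrite -[LHS](divXrK j) -['X_j *: w]opprK -e divXrN vE.
by rewrite scalerA mulrC -scalerA divXrK.
Qed.

(** The first Koszul homology of a free module vanishes because the variables form a regular
    sequence: clearing [n1] and [n2] of x leaves a relation between y and z alone. The witnesses are
    explicit so that [above_cycle] can follow their degrees. *)
Lemma koszul_exact1 n0 n1 n2 : x *: n0 + y *: n1 + z *: n2 = 0 :> 'rV[R]_q ->
  let m1 := n1 - x *: divXr i0 n1 in let m2 := n2 - x *: divXr i0 n2 in
  let w0 := - divXr i1 m2 in
  let w1 := divXr i0 n2 in let w2 := - divXr i0 n1 in
  [/\ n0 = y *: w2 - z *: w1, n1 = z *: w0 - x *: w2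
    & n2 = x *: w1 - y *: w0].
Proof.
move=> e m1 m2 w0 w1 w2.
have n0E : n0 = y *: w2 - z *: w1.
  rewrite -[n0](divXrK i0); have -> : x *: n0 = - (y *: n1 + z *: n2).
    by apply/eqP; rewrite -addr_eq0 addrA e.
  by rewrite divXrN divXrD !divXrM // /w2 /w1 scalerN opprD.
have e' : y *: m1 = - (z *: m2).
  apply/eqP; rewrite -addr_eq0 /m1 /m2.
  apply/eqP; rewrite -[RHS]e [in RHS]n0E -koszul_boundary_row.
  by rewrite /w1 /w2 scalerN.
have [//|m1E m2E] := coprime_vars _ e'.
split; first exact: n0E.
  by rewrite -[z *: w0]m1E /m1 /w2 scalerN opprK subrK.
by rewrite addrC -[- (y *: w0)]m2E /m2 /w1 subrK.
Qed.

Lemma koszul_exact2 w0 w1 w2 :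
  y *: w2 - z *: w1 = 0 -> z *: w0 - x *: w2 = 0 -> x *: w1 - y *: w0 = 0 ->
  let u := divXr i0 w0 in
  [/\ w0 = x *: u, w1 = y *: u & w2 = z *: u :> 'rV[R]_q].
Proof.
move=> /subr0_eq e0 /subr0_eq e1 /subr0_eq e2 u.
have w1E : w1 = y *: u by rewrite -[w1](divXrK i0) e2 divXrM.
have w2E : w2 = z *: u by rewrite -[w2](divXrK i0) -e1 divXrM.
split=> //; rewrite -[w0](divXrK i1) -e2 w1E scalerA mulrC -scalerA.
by rewrite divXrK.
Qed.

End RowVectors.

(** All homogeneous components of [v] in the graded free module with shifts [b] have degree greater
    than [r]; stated on supports, so that [v] need not be homogeneous. *)
Definition above (b : seq int) (r : int) (v : 'rV[R]_(size b)) : Prop :=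
  forall i (u : 'X_{1..3}), u \in msupp (v 0 i) -> r < (mdeg u)%:Z + b`_i.

Arguments above : clear implicits.

Lemma aboveD b r v w : above b r v -> above b r w -> above b r (v + w).
Proof.
move=> av aw i u; rewrite mxE => /msuppD_le; rewrite mem_cat.
by case/orP; [apply: av | apply: aw].
Qed.

Lemma aboveN b r v : above b r v -> above b r (- v).
Proof. by move=> av i u; rewrite mxE (perm_mem (msuppN _)); apply: av. Qed.

Lemma above_scaleX b r i v : above b r v -> above b (r + 1) ('X_i *: v).
Proof.
move=> av j u; rewrite mxE mulrC (perm_mem (msuppMX _ _)).
case/mapP => w /av lt_r ->; rewrite mdegD mdeg1; lia.
Qed.

Lemma above_divXr b r i v : above b (r + 1) v -> above b r (divXr i v).
Proof.
move=> av j u; rewrite mxE => /mdeg_divX [w /av lt_r dw]; lia.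
Qed.

Lemma above_mul a b (A : 'M[R]_(size a, size b)) r v :
  graded_mx A -> above a r v -> above b r (v *m A).
Proof.
move=> gA av j u; rewrite mxE => /msupp_sum_le /flatten_mapP [i _].
case/msuppM_le/allpairsP => -[w1 w2] /= [/av lt_r /gA dw ->].
by rewrite mdegD PoszD dw -addrA subrK.
Qed.

Lemma above_split a r v : {in a, forall c, c <= r} -> above a (r + 1) v ->
  exists v0 v1 v2, [/\ v = x *: v0 + y *: v1 + z *: v2,
    above a r v0, above a r v1 & above a r v2].
Proof.
move=> le_a av.
pose v' := v - x *: divXr i0 v; pose v'' := v' - y *: divXr i1 v'.
have av' : above a (r + 1) v'.
  by apply: aboveD => //; apply/aboveN/above_scaleX/above_divXr.
exists (divXr i0 v), (divXr i1 v'), (divXr i2 v''); split.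
- apply: row_split => // j.
  apply: memN_msupp_eq0; apply/negP => /av; rewrite mdeg0 add0r.
  have := le_a a`_j; rewrite mem_nth // => /(_ isT); lia.
- exact: above_divXr.
- exact: above_divXr.
by apply/above_divXr/aboveD => //; apply/aboveN/above_scaleX/above_divXr.
Qed.

(** The witnesses of [koszul_exact1] involve one more division than multiplication by variables,
    hence the loss of exactly one degree. *)
Lemma above_cycle a r n0 n1 n2 :
    above a (r + 1) n0 -> above a (r + 1) n1 -> above a (r + 1) n2 ->
    x *: n0 + y *: n1 + z *: n2 = 0 ->
  exists w0 w1 w2, [/\ above a r w0, above a r w1, above a r w2 &
    [/\ n0 = y *: w2 - z *: w1, n1 = z *: w0 - x *: w2
      & n2 = x *: w1 - y *: w0]].
Proof.
move=> a0 a1 a2 e.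
exists (- divXr i1 (n2 - x *: divXr i0 n2)), (divXr i0 n2), (- divXr i0 n1).
split; last exact: koszul_exact1 e; last exact/aboveN/above_divXr.
  apply/aboveN/above_divXr/aboveD => //.
  exact/aboveN/above_scaleX/above_divXr.
exact: above_divXr.
Qed.

(* Vanishing of H_0, H_1 and H_2 of the Koszul complex of [N] on x, y, z in   *)
(* the degrees that bound the regularity of [N] by [r]; H_3 is always zero.   *)
Definition koszul_regular b (r : int) (N : 'rV[R]_(size b) -> Prop) : Prop :=
  [/\ forall v, N v -> above b r v ->
        exists n0 n1 n2, [/\ N n0, N n1, N n2 & v = x *: n0 + y *: n1 + z *: n2],
      forall n0 n1 n2, [/\ N n0, N n1 & N n2] ->
        [/\ above b r n0, above b r n1 & above b r n2] ->
        x *: n0 + y *: n1 + z *: n2 = 0 ->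
        exists w0 w1 w2, [/\ N w0, N w1 & N w2] /\
          [/\ n0 = y *: w2 - z *: w1, n1 = z *: w0 - x *: w2
            & n2 = x *: w1 - y *: w0] &
      forall w0 w1 w2, [/\ N w0, N w1 & N w2] ->
        [/\ above b r w0, above b r w1 & above b r w2] ->
        y *: w2 - z *: w1 = 0 -> z *: w0 - x *: w2 = 0 ->
        x *: w1 - y *: w0 = 0 ->
        exists u, N u /\ [/\ w0 = x *: u, w1 = y *: u & w2 = z *: u]].

Arguments koszul_regular : clear implicits.

(** Dimension shift along 0 -> ker A -> F(a) -> N -> 0. The free module has no higher Koszul
    homology, and its H_0 lives in degrees at most [r], so H_i of the kernel is controlled by
    H_(i+1) of [N], one degree higher. *)
Lemma koszul_regular_ker a b (A : 'M[R]_(size a, size b)) r N :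
    graded_mx A -> {in a, forall c, c <= r} ->
    (forall v, N v <-> exists w, v = w *m A) ->
  koszul_regular b r N -> koszul_regular a (r + 1) (fun v => v *m A = 0).
Proof.
move=> gA le_a NA [K0 K1 K2].
have NmA v : N (v *m A) by apply/NA; exists v.
split.
- move=> v vA av.
  have [v0 [v1 [v2 [vE a0 a1 a2]]]] := above_split le_a av.
  have e : x *: (v0 *m A) + y *: (v1 *m A) + z *: (v2 *m A) = 0.
    by rewrite !scalemxAl -!mulmxDl -vE.
  have [w0 [w1 [w2 [[/NA[u0 ->] /NA[u1 ->] /NA[u2 ->]] []]]]] :=
    K1 _ _ _ (And3 (NmA v0) (NmA v1) (NmA v2))
      (And3 (above_mul gA a0) (above_mul gA a1) (above_mul gA a2)) e.
  move=> e0 e1 e2.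
  (* Subtracting the boundary of the lifts [u0], [u1], [u2] keeps the sum [v] and moves each
     coefficient into the kernel of [A]. *)
  exists (v0 - (y *: u2 - z *: u1)), (v1 - (z *: u0 - x *: u2)),
         (v2 - (x *: u1 - y *: u0)).
  split; rewrite ?mulmxBl -?scalemxAl ?e0 ?e1 ?e2 ?subrr //.
  by rewrite koszul_shift_row.
- move=> n0 n1 n2 [A0 A1 A2] [a0 a1 a2] e.
  have [w0 [w1 [w2 [aw0 aw1 aw2 [e0 e1 e2]]]]] := above_cycle a0 a1 a2 e.
  have [|||_ [/NA[u ->] []]] := K2 _ _ _ (And3 (NmA w0) (NmA w1) (NmA w2))
      (And3 (above_mul gA aw0) (above_mul gA aw1) (above_mul gA aw2)).
  + by rewrite !scalemxAl -mulmxBl -e0.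
  + by rewrite !scalemxAl -mulmxBl -e1.
  + by rewrite !scalemxAl -mulmxBl -e2.
  move=> f0 f1 f2; exists (w0 - x *: u), (w1 - y *: u), (w2 - z *: u).
  split; first by split; rewrite mulmxBl -scalemxAl ?f0 ?f1 ?f2 subrr.
  by split; rewrite koszul_shift2_row.
- move=> w0 w1 w2 [A0 A1 A2] _ e0 e1 e2.
  have /= [f0 f1 f2] := koszul_exact2 e0 e1 e2; exists (divXr i0 w0); split=> //.
  by apply: (@scaleX_inj _ i0); rewrite scalemxAl -f0.
Qed.

End KoszulComplex.

Arguments above {K} b r v.
Arguments koszul_regular {K} b r N.

(** * Minimal graded free resolutions *)

(** Enlarge a subspace contained in [P] by a vector of [P] outside it, as long as there is one; the
    codimension bounds the number of steps. *)
Lemma subspace_vspace (K : fieldType) (vT : vectType K) (P : vT -> Prop) :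
    P 0 -> (forall c u v, P u -> P v -> P (c *: u + v)) ->
  exists U : {vspace vT}, forall v, P v <-> v \in U.
Proof.
move=> P0 Plin.
suff H n (U : {vspace vT}) : (forall v, v \in U -> P v) ->
    (dim vT - \dim U <= n)%N -> exists W : {vspace vT}, forall v, P v <-> v \in W.
  by apply: (H _ 0%VS) (leqnn _) => v; rewrite memv0 => /eqP->.
have le_dim (W : {vspace vT}) : (\dim W <= dim vT)%N.
  by rewrite -dimvf dimvS ?subvf.
elim: n U => [|n IH] U UP le_n;
  (case: (classic (exists v, P v /\ v \notin U)) => [[v [Pv vU]]|noP]; last first).
- exists U => v; split=> [Pv|]; last exact: UP.
  by apply: contraT => vU; case: noP; exists v.
- have /eqP UE : U == fullv by rewrite eqEdim subvf dimvf; lia.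
  by rewrite UE memvf in vU.
- exists U => v; split=> [Pv|]; last exact: UP.
  by apply: contraT => vU; case: noP; exists v.
apply: (IH (U + <[v]>)%VS) => [w /memv_addP [u uU [_ /vlineP[c ->] ->]]|].
  by rewrite addrC; apply: Plin => //; apply: UP.
suff : (\dim U < \dim (U + <[v]>))%N by have := le_dim (U + <[v]>)%VS; lia.
rewrite ltnNge; apply: contra vU => le_dimU.
have /eqP -> : U == (U + <[v]>)%VS by rewrite eqEdim addvSl.
by rewrite (subvP (addvSr _ _)) ?memv_line.
Qed.

(** * Homogeneous components of polynomials and of row vectors *)

Section Grading.
Variables (k : nat) (K : fieldType).
Local Notation R := {mpoly K[k]}.
Implicit Types (f g : R) (u : 'X_{1..k}).

Definition homog_part (j : int) : R -> R :=
  mlin (fun u => if (mdeg u)%:Z == j then 'X_[u] else 0 : R).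

HB.instance Definition _ j := GRing.Linear.on (homog_part j).

Lemma homog_partX j u :
  homog_part j 'X_[u] = if (mdeg u)%:Z == j then 'X_[u] else 0.
Proof. exact: mlinX. Qed.

Lemma mcoeff_homog_part j f u :
  (homog_part j f)@_u = if (mdeg u)%:Z == j then f@_u else 0.
Proof.
elim/mpolyind: f => [|c w f _ _ IH]; first by rewrite linear0 mcoeff0 if_same.
rewrite linearD !mcoeffD IH linearZ /= homog_partX !mcoeffZ mcoeffX.
case: (eqVneq w u) => [->|ne].
  by case: ifP; rewrite ?mcoeffX ?eqxx ?mcoeff0 ?mulr0 ?addr0.
by rewrite mulr0 add0r; case: ifP; rewrite ?mcoeffX ?(negbTE ne) ?mcoeff0 ?mulr0 ?add0r.
Qed.

Lemma homog_partM (j c : int) f g :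
    (forall u, u \in msupp g -> (mdeg u)%:Z = c) ->
  homog_part j (f * g) = homog_part (j - c) f * g.
Proof.
move=> gc; elim/mpolyind: f => [|d u f _ _ IH]; first by rewrite mul0r !linear0 mul0r.
rewrite mulrDl !linearD /= mulrDl IH; congr (_ + _).
rewrite -scalerAl !linearZ /= -scalerAl homog_partX; congr (_ *: _).
rewrite [g in LHS]mpolyE mulr_sumr linear_sum /= [g in RHS]mpolyE mulr_sumr.
rewrite !big_seq; apply: eq_bigr => w /gc dw.
rewrite -scalerAr linearZ /= -scalerAr -mpolyXD homog_partX mdegD PoszD dw.
have -> : ((mdeg u)%:Z + c == j) = ((mdeg u)%:Z == j - c).
  by rewrite eq_sym -subr_eq eq_sym.
by case: ifP; rewrite ?mul0r // mpolyXD.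
Qed.

Lemma homog_part_deg j f u : u \in msupp (homog_part j f) -> (mdeg u)%:Z = j.
Proof. by rewrite mcoeff_msupp mcoeff_homog_part; case: (_ =P j) => [e _|_ /eqP[]]. Qed.

Definition homog_row (b : seq int) (j : int) (v : 'rV[R]_(size b)) :
  'rV[R]_(size b) := \row_i homog_part (j - b`_i) (v 0 i).

Lemma homog_rowD b j (v w : 'rV_(size b)) :
  homog_row j (v + w) = homog_row j v + homog_row j w.
Proof. by apply/rowP => i; rewrite !mxE linearD. Qed.

Lemma homog_row0 b j : homog_row j 0 = 0 :> 'rV_(size b).
Proof. by apply/rowP => i; rewrite !mxE linear0. Qed.

Lemma homog_row_mul a b (A : 'M[R]_(size a, size b)) j v :
  graded_mx A -> homog_row j (v *m A) = homog_row j v *m A.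
Proof.
move=> gA; apply/rowP => h; rewrite !mxE linear_sum /=; apply: eq_bigr => i _.
rewrite !mxE (@homog_partM _ (a`_i - b`_h)); last by move=> u /gA.
by congr (homog_part _ _ * _); ring.
Qed.

Lemma homog_row_sum b (v : 'rV_(size b)) :
  exists s : seq int, v = \sum_(j <- s) homog_row j v.
Proof.
exists (undup (flatten [seq [seq (mdeg u)%:Z + b`_i | u <- msupp (v 0 i)]
          | i : 'I_(size b) <- enum 'I_(size b)])).
set s := undup _; apply/rowP => i; apply/mpolyP => u.
rewrite summxE raddf_sum /=.
under eq_bigr => j _ do rewrite mxE mcoeff_homog_part eq_sym subr_eq.
rewrite -big_mkcond /= big_const_seq iter_addr addr0.
rewrite (count_uniq_mem _ (undup_uniq _)) mem_undup.
case: (boolP (_ \in _)) => [_|]; first by [].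
have [uv|/memN_msupp_eq0 ->] := boolP (u \in msupp (v 0 i)); last by rewrite mul0rn.
case/negP; apply/flatten_mapP; exists i; first by rewrite mem_enum.
by apply/mapP; exists u.
Qed.

End Grading.

(** * Generating families and minimality *)

Section Generators.
Variables (k : nat) (K : fieldType) (b : seq int).
Local Notation R := {mpoly K[k]}.
Local Notation M := 'rV[R]_(size b).
Implicit Types (N : M -> Prop) (s : seq (int * M)).

(** The span as an intersection of submodules, convenient for closure arguments; [span_mxP] recovers
    coordinates. *)
Definition in_span s (v : M) : Prop :=
  forall N, is_submodule N -> (forall p, p \in s -> N p.2) -> N v.

Lemma in_span_submodule s : is_submodule (in_span s).
Proof.
split=> [N [] //|v w sv sw N sN Ns|c v sv N sN Ns]; case: (sN) => N0 ND NZ.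
  by apply: ND; [apply: sv | apply: sw].
by apply: NZ; apply: sv.
Qed.

Lemma in_span_mem s p : p \in s -> in_span s p.2.
Proof. by move=> ps N _; apply. Qed.

Lemma in_span_sub s s' v :
  (forall p, p \in s -> in_span s' p.2) -> in_span s v -> in_span s' v.
Proof. by move=> ss' sv; apply: sv => //; apply: in_span_submodule. Qed.

Lemma submodule_sum N (I : Type) (r : seq I) (P : pred I) (F : I -> M) :
  is_submodule N -> (forall i, P i -> N (F i)) -> N (\sum_(i <- r | P i) F i).
Proof. by case=> N0 ND _ NF; elim/big_ind: _. Qed.

Definition span_degs s : seq int := map fst s.

Lemma size_degs s : size (span_degs s) = size s.
Proof. exact: size_map. Qed.

Lemma ltn_degs s (i : 'I_(size (span_degs s))) : (i < size s)%N.
Proof. by rewrite -[X in (_ < X)%N]size_degs. Qed.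

Definition span_mx s : 'M[R]_(size (span_degs s), size b) :=
  \matrix_(i < size (span_degs s), j < size b) (nth (0, 0) s i).2 0 j.

Lemma row_span_mx s i : row i (span_mx s) = (nth (0, 0) s i).2.
Proof. by apply/rowP => j; rewrite !mxE. Qed.

Lemma span_mxP s v : in_span s v <-> exists w, v = w *m span_mx s.
Proof.
split=> [|[w ->]]; last first.
  rewrite mulmx_sum_row; apply: submodule_sum (in_span_submodule s) _ => i _.
  have [_ _ sZ] := in_span_submodule s.
  rewrite row_span_mx; apply: sZ; apply: in_span_mem; apply: mem_nth.
  exact: ltn_degs.
move/(_ (fun v => exists w, v = w *m span_mx s)); apply; first split.
- by exists 0; rewrite mul0mx.
- by move=> _ _ [w1 ->] [w2 ->]; exists (w1 + w2); rewrite mulmxDl.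
- by move=> c _ [w ->]; exists (c *: w); rewrite scalemxAl.
move=> p ps; have lt_p : (index p s < size (span_degs s))%N.
  by rewrite size_map index_mem.
by exists (delta_mx 0 (Ordinal lt_p)); rewrite -rowE row_span_mx /= nth_index.
Qed.

Definition homogeneous_family s : Prop :=
  forall p, p \in s -> homog_row p.1 p.2 = p.2.

Lemma graded_span_mx s : homogeneous_family s -> graded_mx (span_mx s).
Proof.
move=> hs i j u; have lt_i : (i < size s)%N by exact: ltn_degs.
rewrite mxE -(hs _ (mem_nth (0, 0) lt_i)) mxE => /homog_part_deg ->.
by rewrite /span_degs (nth_map (0, 0)).
Qed.

(** Graded Nakayama: a relation with a nonzero constant coefficient expresses one generator through
    the others, which could then be dropped. *)
Lemma minimal_relation s : homogeneous_family s ->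
    (forall s', (forall v, in_span s v -> in_span s' v) ->
                {subset s' <= s} -> (size s <= size s')%N) ->
  forall v : 'rV_(size (span_degs s)),
    v *m span_mx s = 0 -> forall i, (v 0 i)@_0 = 0.
Proof.
move=> hs smin v vA i; apply/eqP/contraT => c0; set c := _@__ in c0.
have lt_i : (i < size s)%N by exact: ltn_degs.
set a := span_degs s in v vA i c c0 lt_i *.
pose v' := homog_row a`_i v.
have v'A : v' *m span_mx s = 0.
  by rewrite -homog_row_mul ?vA ?homog_row0 //; apply: graded_span_mx.
have v'i : v' 0 i = c%:MP.
  apply/mpolyP => u; rewrite mxE mcoeff_homog_part subrr mcoeffC eqz_nat.
  rewrite mdeg_eq0; case: eqP => [->|]; first by rewrite mulr1.
  by rewrite mulr0.
pose s' := take i s ++ drop i.+1 s.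
have s's l : (l < size s)%N -> l != i -> nth (0, 0) s l \in s'.
  move=> lt_l ne; rewrite mem_cat; case: (ltngtP l i) ne => // lt_li _.
    by rewrite -(nth_take (0, 0) lt_li) mem_nth // size_takel // ltnW.
  rewrite -[l](subnKC lt_li) -nth_drop mem_nth ?orbT //.
  by rewrite size_drop ltn_sub2r // (leq_ltn_trans lt_li).
suff : (size s <= size s')%N.
  rewrite size_cat size_takel ?(ltnW lt_i) // size_drop; lia.
have [_ _ spZ] := in_span_submodule s'.
apply: smin => [w|p]; last by rewrite mem_cat => /orP[/mem_take|/mem_drop].
apply: in_span_sub => p ps.
have [lt_p pE] : (index p s < size s)%N /\ p = nth (0, 0) s (index p s).
  by rewrite index_mem nth_index.
case: (eqVneq (index p s) i) => [e|ne]; last first.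
  by apply: in_span_mem; rewrite pE; apply: s's.
rewrite pE e -row_span_mx.
have -> : row i (span_mx s) =
    (- c^-1)%:MP *: \sum_(l | l != i) v' 0 l *: row l (span_mx s).
  move: v'A; rewrite mulmx_sum_row (bigD1 i) //= v'i => /eqP.
  rewrite addr_eq0 => /eqP/(congr1 (fun w => (c^-1)%:MP *: w)).
  rewrite scalerA -mpolyCM mulVf // mpolyC1 scale1r => ->.
  by rewrite scalerN mpolyCN scaleNr.
apply: (spZ); apply: submodule_sum (in_span_submodule s') _ => l ne.
rewrite row_span_mx; apply: spZ; apply: in_span_mem; apply: s's => //.
exact: ltn_degs.
Qed.

Lemma minimal_family (P : seq (int * M) -> Prop) s0 : P s0 ->
  exists s, P s /\ forall s', P s' -> (size s <= size s')%N.
Proof.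
move: {2}(size s0) (leqnn (size s0)) => n; elim: n s0 => [|n IH] s0 le_n Ps0.
  by exists s0; split=> // s' _; apply: leq_trans le_n _.
case: (classic (exists s', P s' /\ (size s' < size s0)%N)) => [[s' [Ps' lt_s]]|no].
  by apply: (IH s') => //; rewrite -ltnS (leq_trans lt_s).
by exists s0; split=> // s' Ps'; rewrite leqNgt; apply/negP => lt_s; case: no; exists s'.
Qed.

End Generators.

Section BoundedRows.
Variables (k : nat) (K : fieldType) (D q : nat).
Local Notation R := {mpoly K[k]}.
Local Notation T := 'X_{1..k < D}.

Definition row_of_coefs (c : {ffun T -> 'rV[K]_q}) : 'rV[R]_q :=
  \row_i \sum_(t : T) c t 0 i *: 'X_[t].

Lemma row_of_coefsP a c d :
  row_of_coefs (a *: c + d) = a%:MP *: row_of_coefs c + row_of_coefs d.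
Proof.
apply/rowP => i; rewrite !mxE mulr_sumr -big_split /=; apply: eq_bigr => t _.
by rewrite !ffunE !mxE scalerDl mul_mpolyC scalerA.
Qed.

Lemma row_of_coefs_onto (v : 'rV[R]_q) :
    (forall i (u : 'X_{1..k}), u \in msupp (v 0 i) -> (mdeg u < D)%N) ->
  exists c, v = row_of_coefs c.
Proof.
move=> vD; exists [ffun t : T => \row_i (v 0 i)@_t].
apply/rowP => i; rewrite mxE.
have le_D : (msize (v 0%R i) <= D)%N.
  rewrite msizeE big_seq; apply/bigmax_leqP_seq => u uv _; exact: vD uv.
by rewrite {1}[v 0 i](mpolywE le_D); apply: eq_bigr => t _; rewrite ffunE mxE.
Qed.

(** Vectors of polynomials of degree less than [D] form a finite-dimensional space. This takes the
    place of Hilbert's basis theorem. *)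
Lemma row_of_coefs_basis (N : 'rV[R]_q -> Prop) : is_submodule N ->
  exists s : seq 'rV[R]_q, (forall v, v \in s -> N v) /\
    forall v, N v -> (forall i (u : 'X_{1..k}), u \in msupp (v 0 i) -> (mdeg u < D)%N) ->
      exists c : nat -> K, v = \sum_(l < size s) (c l)%:MP *: nth 0 s l.
Proof.
move=> [N0 ND NZ].
have dec0 : row_of_coefs 0 = 0.
  have := row_of_coefsP (-1) 0 0.
  by rewrite scaler0 addr0 mpolyCN mpolyC1 scaleN1r addNr.
have [] := @subspace_vspace _ {ffun T -> 'rV[K]_q} (fun c => N (row_of_coefs c)).
- by rewrite dec0.
- by move=> a c d Nc Nd; rewrite row_of_coefsP; apply: ND => //; apply: NZ.
move=> U NU; exists (map row_of_coefs (vbasis U)); split.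
  by move=> _ /mapP [c cU ->]; apply/NU; apply: vbasis_mem.
move=> v Nv /row_of_coefs_onto [c vE]; rewrite {}vE in Nv *.
have cU := (NU c).1 Nv.
exists (fun l => if insub l is Some i then coord (vbasis U) i c else 0).
rewrite size_map {1}(coord_vbasis cU).
transitivity (\sum_(i < \dim U) (coord (vbasis U) i c)%:MP *: row_of_coefs (vbasis U)`_i).
  elim/big_rec2: _ => [|i w1 w2 _ <-]; first exact: dec0.
  exact: row_of_coefsP.
rewrite -(big_mkord xpredT
  (fun l => (if insub l is Some i then coord (vbasis U) i c else 0)%:MP
            *: nth 0 (map row_of_coefs (vbasis U)) l)) size_tuple big_mkord.
apply: eq_bigr => i _; rewrite valK (nth_map 0) ?size_tuple //.
Qed.

End BoundedRows.

(** * Minimal free covers of Koszul regular submodules *)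

Section MinimalCover.
Variables (K : fieldType) (b : seq int) (r : int).
Local Notation R := {mpoly K[3]}.
Local Notation M := 'rV[R]_(size b).
Variable N : M -> Prop.
Hypotheses (subN : is_submodule N) (gradN : forall v j, N v -> N (homog_row j v)).
Hypothesis regN : koszul_regular b r N.

Definition generating_family (s : seq (int * M)) : Prop :=
  [/\ homogeneous_family s, forall p, p \in s -> N p.2 /\ p.1 <= r
    & forall v, N v -> in_span s v].

Lemma homog_row_id j (v : M) : homog_row j (homog_row j v) = homog_row j v.
Proof.
apply/rowP => i; rewrite !mxE; apply/mpolyP => u.
by rewrite !mcoeff_homog_part; case: (_ == _).
Qed.

Lemma homog_rowC j c (v : M) : homog_row j (c%:MP *: v) = c%:MP *: homog_row j v.
Proof. by apply/rowP => i; rewrite !mxE !mul_mpolyC linearZ. Qed.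

Lemma homog_rowX i j (v : M) : homog_row j ('X_i *: v) = 'X_i *: homog_row (j - 1) v.
Proof.
apply/rowP => h; rewrite !mxE mulrC (@homog_partM _ _ _ 1) 1?mulrC.
  by congr (_ * homog_part _ _); ring.
by move=> u; rewrite msuppX mem_seq1 => /eqP->; rewrite mdeg1.
Qed.

(** Up to degree [r] only finitely many components are nonzero, each finite-dimensional. Above [r],
    vanishing of H_0 writes an element through elements of degree one less, by induction. *)
Lemma exists_generating_family : exists s, generating_family s.
Proof.
(* With this [D], a component of degree r - l has entries of degree less than [D], and is 0 as soon
   as l >= D. *)
have [D ltD] : exists D, forall i : 'I_(size b), (`|(r - b`_i)%R| < D)%N.
  exists (\sum_(i < size b) `|(r - b`_i)%R|%N).+1 => i.
  by rewrite ltnS (bigD1 i) //= leq_addr.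
have [s0 [s0N s0gen]] := row_of_coefs_basis D subN.
pose s := [seq (j, homog_row j v) | j <- [seq r - l%:Z | l <- iota 0 D], v <- s0].
have memP p : p \in s -> exists l v, [/\ v \in s0, p.1 = r - l%:Z & p.2 = homog_row p.1 v].
  case/allpairsP => -[j v] [/mapP [l _ jE] vs ->]; exists l, v; split=> //.

have smem l v : (l < D)%N -> v \in s0 -> in_span s (homog_row (r - l%:Z) v).
  move=> lt_l vs.
  apply: (@in_span_mem _ _ _ s (r - l%:Z, homog_row (r - l%:Z) v)).
  apply/allpairsP; exists (r - l%:Z, v); split=> //=.
  by apply: map_f; rewrite mem_iota.
have low l v : N v -> in_span s (homog_row (r - l%:Z) v).
  move=> /(gradN (r - l%:Z)); set w := homog_row _ v => Nw.
  have wE : homog_row (r - l%:Z) w = w by apply: homog_row_id.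
  have [_ _ spZ] := in_span_submodule s.
  have wdeg i (u : 'X_{1..3}) : u \in msupp (w 0 i) -> (mdeg u)%:Z = r - l%:Z - b`_i.
    by rewrite mxE => /homog_part_deg.
  case: (ltnP l D) => [lt_l|le_D].
    have [|c wc] := s0gen _ Nw.
      by move=> i u /wdeg; have := ltD i; lia.
    rewrite -wE wc (big_morph _ (homog_rowD (r - l%:Z)) (homog_row0 _ _ _ _)).
    apply: submodule_sum (in_span_submodule s) _ => i _.
    rewrite homog_rowC; apply: spZ; apply: smem => //; exact: mem_nth.
  suff -> : w = 0 by case: (in_span_submodule s).
  apply/rowP => i; rewrite [RHS]mxE; apply/eqP; rewrite -msupp_eq0.
  case E : (msupp (w 0 i)) => [//|u t].
  have /wdeg : u \in msupp (w 0 i) by rewrite E mem_head.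
  have := ltD i; lia.
have hom l v : N v -> in_span s (homog_row (r + l%:Z) v).
  elim: l v => [|l IH] v Nv.
    by rewrite addr0 -[r]subr0; apply: (low 0%N).
  case: regN => K0 _ _.
  have [|n0 [n1 [n2 [N0 N1 N2 vE]]]] := K0 _ (gradN (r + l.+1%:Z) Nv).
    by move=> i u; rewrite mxE => /homog_part_deg ->; lia.
  rewrite -homog_row_id vE !homog_rowD !homog_rowX.
  have -> : r + l.+1%:Z - 1 = r + l%:Z by lia.
  have [_ spD spZ] := in_span_submodule s.
  apply: (spD) (spZ _ _ (IH _ N2)); exact: spD (spZ _ _ (IH _ N0)) (spZ _ _ (IH _ N1)).
exists s; split.
- by move=> p /memP [l [v [_ _ ->]]]; apply: homog_row_id.
- move=> p /memP [l [v [/s0N Nv p1 ->]]]; split; first exact: gradN.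
  by rewrite p1 gerBl.
- move=> v Nv; have [js vE] := homog_row_sum v; rewrite vE.
  apply: submodule_sum (in_span_submodule s) _ => j _.
  case: (leP j r) => [le_j|lt_j].
    by rewrite (_ : j = r - `|(r - j)%R|%N%:Z); [apply: low|lia].
  by rewrite (_ : j = r + `|(r - j)%R|%N%:Z); [apply: hom|lia].
Qed.

Lemma minimal_cover :
  exists a (A : 'M[R]_(size a, size b)),
    [/\ {in a, forall c, c <= r}, graded_mx A,
        forall v, N v <-> exists w, v = w *m A
      & forall v : 'rV_(size a), v *m A = 0 -> forall i, (v 0 i)@_0 = 0].
Proof.
have [s0 gs0] := exists_generating_family.
have [s [[hs sN sgen] smin]] := minimal_family gs0.
exists (span_degs s), (span_mx s); split.
- by move=> c /mapP [p /sN [_ le_p] ->].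
- exact: graded_span_mx.
- move=> v; rewrite -span_mxP; split; first exact: sgen.
  by apply=> // p /sN[].
apply: minimal_relation => // s' ss' sub; apply: smin; split.
- by move=> p /sub; apply: hs.
- by move=> p /sub; apply: sN.
- by move=> v /sgen; apply: ss'.
Qed.
End MinimalCover.

(** * The resolution as an iteration of minimal covers *)

Section Resolution.
Variable K : fieldType.
Local Notation R := {mpoly K[3]}.

Definition minimal_relations (a b : seq int) (A : 'M[R]_(size a, size b)) : Prop :=
  forall v : 'rV_(size a), v *m A = 0 -> forall i, (v 0 i)@_0 = 0.

Record stage := Stage {
  stage_src : seq int;
  stage_tgt : seq int;
  stage_mx : 'M[R]_(size stage_src, size stage_tgt);
  stage_bound : int
}.

(** The invariant of the iteration. The last clause says that the kernel has no constant entries,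
    which makes the next differential minimal. *)
Definition good_stage (s : stage) : Prop :=
  [/\ {in stage_src s, forall c, c <= stage_bound s}, graded_mx (stage_mx s),
      koszul_regular (stage_src s) (stage_bound s + 1)
        (fun v => v *m stage_mx s = 0)
    & minimal_relations (stage_mx s)].

Definition next_map (s : stage) :=
  {a : seq int & 'M[R]_(size a, size (stage_src s))}.

Definition next_stage (s : stage) (aA : next_map s) : stage :=
  Stage (projT2 aA) (stage_bound s + 1).

Definition next_spec (s : stage) (aA : next_map s) : Prop :=
  good_stage (next_stage aA) /\
  forall v : 'rV_(size (stage_src s)), v *m stage_mx s = 0 <-> exists w, v = w *m projT2 aA.

(** Stated for every stage, with a dummy map for bad ones, so that [iter_stage] is a plain recursion
    on data and goodness is proved afterwards. *)
Lemma next_exists (s : stage) :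
  exists aA : next_map s, good_stage s -> next_spec aA.
Proof.
case: (classic (good_stage s)) => [[le_s gs ks ms]|bad]; last first.
  by exists (existT _ [::] (const_mx 0)).
have subN : is_submodule (fun v : 'rV_(size (stage_src s)) => v *m stage_mx s = 0).
  split=> [|v w ev ew|c v ev]; first by rewrite mul0mx.
    by rewrite mulmxDl ev ew addr0.
  by rewrite -scalemxAl ev scaler0.
have gradN (v : 'rV_(size (stage_src s))) j :
    v *m stage_mx s = 0 -> homog_row j v *m stage_mx s = 0.
  by move=> ev; rewrite -homog_row_mul // ev homog_row0.
have [a [A [le_a gA imA mA]]] := minimal_cover subN gradN ks.
exists (existT _ a A) => _; split=> //; split=> //=.
exact: (koszul_regular_ker gA le_a imA ks).
Qed.

Definition choose_next (s : stage) : next_map s :=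
  proj1_sig (constructive_indefinite_description _ (next_exists s)).

Lemma choose_nextP s : good_stage s -> next_spec (choose_next s).
Proof.
exact: (proj2_sig (constructive_indefinite_description _ (next_exists s))).
Qed.

Fixpoint iter_stage (s : stage) (p : nat) : stage :=
  if p is p'.+1 then next_stage (choose_next (iter_stage s p')) else s.

Lemma good_iter s p : good_stage s -> good_stage (iter_stage s p).
Proof. by move=> gs; elim: p => // p /choose_nextP []. Qed.

Lemma iter_bound s p : stage_bound (iter_stage s p) = stage_bound s + p%:Z.
Proof. by elim: p => [|p /= ->]; [rewrite addr0|lia]. Qed.

Lemma regular_resolution (J : R -> Prop) (r : int) :
    is_ideal J -> (forall f j, J f -> J (homog_part j f)) ->
    koszul_regular [:: 0 : int] r (fun v => J (v 0 0)) ->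
  exists F : min_graded_free_resolution J,
    forall p, {in shifts F p, forall c, c <= r + p%:Z}.
Proof.
move=> [J0 JD JM] Jgr Jreg; pose b := [:: 0 : int].
have subJ : is_submodule (fun v : 'rV[R]_(size b) => J (v 0 0)).
  split=> [|v w|c v]; rewrite !mxE; [exact: J0|exact: JD|exact: JM].
have gradJ (v : 'rV[R]_(size b)) j : J (v 0 0) -> J (homog_row j v 0 0).
  by rewrite mxE; apply: Jgr.
have [a [A [le_a gA imA mA]]] := minimal_cover subJ gradJ Jreg.
pose s := @Stage a b A r.
have gs : good_stage s by split=> //=; exact: (koszul_regular_ker gA le_a imA Jreg).
pose sh p := stage_src (iter_stage s p).
pose df p : 'M[R]_(size (sh p.+1), size (sh p)) :=
  projT2 (choose_next (iter_stage s p)).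
have H p := choose_nextP (good_iter p gs).
have augim f : J f <-> exists v : 'rV_(size (sh 0%N)), f = (v *m A) 0 0.
  split=> [Jf|[v ->]]; last by apply/(imA (v *m A)); exists v.
  have [|v e] := (imA (const_mx f)).1; first by rewrite mxE.
  by exists v; rewrite -e mxE.
have dfg p : graded_mx (df p) by have [[_ g _ _] _] := H p.
have dfe0 (v : 'rV_(size (sh 0%N))) : v *m A = 0 <-> exists w, v = w *m df 0%N.
  by have [_ ] := H 0%N; apply.
have dfe p (v : 'rV_(size (sh p.+1))) : v *m df p = 0 <-> exists w, v = w *m df p.+1.
  by have [_ ] := H p.+1; apply.
(* Each row of [df p] lies in the kernel of the preceding map, and such vectors have no constant
   terms. *)
have dfm p i j : (df p i j)@_0%MM = 0.
  have [_ _ _ m] := good_iter p gs; have [_ e] := H p.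
  suff ri : row i (df p) *m stage_mx (iter_stage s p) = 0.
    by have := m _ ri j; rewrite mxE.
  by apply/e; exists (delta_mx 0 i); rewrite -rowE.
exists (@MinGradedFreeResolution _ _ J sh A df gA dfg augim dfe0 dfe dfm) => p c /=.
by have [le_c _ _ _] := good_iter p gs; move=> /le_c; rewrite iter_bound.
Qed.

End Resolution.

(** * A regularity criterion *)

Section KoszulHomotopy.
Variable R : comNzRingType.
Implicit Types (x y z a b c f n w h u g : R).

(** Multiplication by g = xa + yb + zc is null-homotopic on the Koszul complex, through the product
    with (a, b, c). This is the homotopy identity in degree 1, with the term of degree 2 corrected
    by multiples g w_i. *)
Lemma homotopy_cycle x y z a b c f0 f1 f2 w0 w1 w2 (g := x * a + y * b + z * c)
    (f := x * f0 + y * f1 + z * f2) (h0 := c * f1 - b * f2 - g * w0)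
    (h1 := a * f2 - c * f0 - g * w1) (h2 := b * f0 - a * f1 - g * w2) :
  [/\ g * (f0 - (y * w2 - z * w1)) = a * f + y * h2 - z * h1,
      g * (f1 - (z * w0 - x * w2)) = b * f + z * h0 - x * h2
    & g * (f2 - (x * w1 - y * w0)) = c * f + x * h1 - y * h0].
Proof. by rewrite /h0 /h1 /h2 /f /g; split; ring. Qed.

(** The same homotopy in degree 2. *)
Lemma homotopy_boundary x y z a b c w0 w1 w2 u (g := x * a + y * b + z * c)
    (h := a * w0 + b * w1 + c * w2 - g * u) (n0 := y * w2 - z * w1)
    (n1 := z * w0 - x * w2) (n2 := x * w1 - y * w0) :
  [/\ g * (w0 - x * u) = x * h + c * n1 - b * n2,
      g * (w1 - y * u) = y * h + a * n2 - c * n0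
    & g * (w2 - z * u) = z * h + b * n0 - a * n1].
Proof. by rewrite /h /n0 /n1 /n2 /g; split; ring. Qed.

End KoszulHomotopy.

Section RegularityCriterion.
Variable K : fieldType.
Local Notation R := {mpoly K[3]}.
Local Notation i0 := (@Ordinal 3 0 isT).
Local Notation i1 := (@Ordinal 3 1 isT).
Local Notation i2 := (@Ordinal 3 2 isT).
Local Notation x := ('X_i0 : R).
Local Notation y := ('X_i1 : R).
Local Notation z := ('X_i2 : R).

Definition order_ge (t : nat) (f : R) : Prop :=
  forall u : 'X_{1..3}, u \in msupp f -> (t <= mdeg u)%N.

Lemma order_geD t f h : order_ge t f -> order_ge t h -> order_ge t (f + h).
Proof.
move=> tf th u /msuppD_le; rewrite mem_cat; case/orP; [exact: tf|exact: th].
Qed.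

Lemma order_geN t f : order_ge t f -> order_ge t (- f).
Proof. by move=> tf u; rewrite (perm_mem (msuppN _)); apply: tf. Qed.

Lemma order_geM s t f h : order_ge s f -> order_ge t h -> order_ge (s + t) (f * h).
Proof.
move=> sf th u /msuppM_le/allpairsP [[v w] /= [/sf le_s /th le_t ->]].
by rewrite mdegD leq_add.
Qed.

Lemma above1P (r : nat) (v : 'rV[R]_1) :
  above [:: 0 : int] (r%:Z - 1) v <-> order_ge r (v 0 0).
Proof.
split=> [av u /av /=|rv i u]; first by rewrite addr0; lia.
by rewrite (ord1 i) => /rv /= le_r; rewrite addr0; lia.
Qed.

Variables (J : R -> Prop) (d e : nat) (g0 g1 g2 : R).
Hypothesis idJ : is_ideal J.
Hypothesis d_gt0 : (0 < d)%N.
Hypotheses (g0_ge : order_ge e g0) (g1_ge : order_ge e g1) (g2_ge : order_ge e g2).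
Local Notation g := (x * g0 + y * g1 + z * g2).
Hypothesis nzd : forall f, J (g * f) -> J f.
Hypothesis onto : forall h, order_ge (d + e) h -> exists u, J (h - g * u).

Let JD f h : J f -> J h -> J (f + h).
Proof. by case: idJ => _ + _; apply. Qed.

Let JM c f : J f -> J (c * f).
Proof. by case: idJ => _ _ +; apply. Qed.

Let JB f h : J f -> J h -> J (f - h).
Proof. by move=> Jf Jh; apply: JD => //; rewrite -mulN1r; apply: JM. Qed.

Let onto2 a b f h : order_ge e a -> order_ge e b -> order_ge d f ->
  order_ge d h -> exists u, J (a * f - b * h - g * u).
Proof.
move=> ea eb df dh; apply: onto; rewrite addnC.
by apply: order_geD; [exact: order_geM|apply/order_geN; exact: order_geM].
Qed.

(** A Koszul cycle modulo [J] becomes a boundary after multiplication by g. The homotopy term has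
    order at least d + e, hence equals a multiple of g modulo [J]; then g can be cancelled from the
    identity, being regular modulo [J]. *)
Lemma koszul_regular_criterion :
  koszul_regular [:: 0 : int] d%:Z (fun v => J (v 0 0)).
Proof.
have dE : d%:Z = d%:Z - 1 + 1 by rewrite subrK.
have le0 : {in [:: 0 : int], forall c, c <= d%:Z - 1}.
  by move=> c; rewrite mem_seq1 => /eqP->; lia.
split.
- move=> v Jv; rewrite dE => /(above_split le0) [v0 [v1 [v2 [vE]]]].
  move=> /above1P a0 /above1P a1 /above1P a2.
  have [w0 Jw0] := onto2 g2_ge g1_ge a1 a2.
  have [w1 Jw1] := onto2 g0_ge g2_ge a2 a0.
  have [w2 Jw2] := onto2 g1_ge g0_ge a0 a1.
  exists (v0 - (y *: const_mx w2 - z *: const_mx w1)),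
         (v1 - (z *: const_mx w0 - x *: const_mx w2)),
         (v2 - (x *: const_mx w1 - y *: const_mx w0)).
  have Jf : J (x * v0 0 0 + y * v1 0 0 + z * v2 0 0) by move: Jv; rewrite vE rowZ3.
  have [E0 E1 E2] := homotopy_cycle x y z g0 g1 g2 (v0 0 0) (v1 0 0) (v2 0 0) w0 w1 w2.
  split; last by rewrite koszul_shift_row.
  + rewrite !mxE; apply: nzd; rewrite E0.
    by apply: JB; [apply: JD|]; apply: JM.
  + rewrite !mxE; apply: nzd; rewrite E1.
    by apply: JB; [apply: JD|]; apply: JM.
  + rewrite !mxE; apply: nzd; rewrite E2.
    by apply: JB; [apply: JD|]; apply: JM.
- move=> n0 n1 n2 [J0 J1 J2]; rewrite {1 2 3}dE => -[a0 a1 a2] E.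
  have [w0 [w1 [w2 [/above1P aw0 /above1P aw1 /above1P aw2 [e0 e1 e2]]]]] :=
    above_cycle a0 a1 a2 E.
  have [u Ju] : exists u, J (g0 * w0 0 0 + g1 * w1 0 0 + g2 * w2 0 0 - g * u).
    apply: onto; rewrite addnC.
    by apply: order_geD; [apply: order_geD|]; apply: order_geM.
  pose U : 'rV[R]_1 := const_mx u.
  exists (w0 - x *: U), (w1 - y *: U), (w2 - z *: U).
  split; last by rewrite e0 e1 e2; split; rewrite koszul_shift2_row.
  have f0 : n0 0 0 = y * w2 0 0 - z * w1 0 0 by rewrite e0 !mxE.
  have f1 : n1 0 0 = z * w0 0 0 - x * w2 0 0 by rewrite e1 !mxE.
  have f2 : n2 0 0 = x * w1 0 0 - y * w0 0 0 by rewrite e2 !mxE.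
  have [E0 E1 E2] := homotopy_boundary x y z g0 g1 g2 (w0 0 0) (w1 0 0) (w2 0 0) u.
  split; rewrite rowBZ mxE; apply: nzd; rewrite ?E0 ?E1 ?E2 -?f0 -?f1 -?f2;
    by apply: JB; [apply: JD|]; apply: JM.
- move=> w0 w1 w2 [J0 J1 J2] _ e0 e1 e2.
  have [f0 f1 f2] := koszul_exact2 e0 e1 e2.
  exists (divXr i0 w0); split=> //; apply: nzd.
  have Jx : J (x * divXr i0 w0 0 0) by move: J0; rewrite {1}f0 mxE.
  have Jy : J (y * divXr i0 w0 0 0) by move: J1; rewrite {1}f1 mxE.
  have Jz : J (z * divXr i0 w0 0 0) by move: J2; rewrite {1}f2 mxE.
  have -> (f : R) : g * f = g0 * (x * f) + g1 * (y * f) + g2 * (z * f).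
    by rewrite !mulrDl [x * _]mulrC [y * g1]mulrC [z * g2]mulrC !mulrA.
  by apply: JD; [apply: JD|]; apply: JM.
Qed.
End RegularityCriterion.

(** * Ideals and localization *)

Section IdealTheory.
Variable R : comNzRingType.
Implicit Types (S I L Q : R -> Prop) (f g h a b : R).

Lemma idealB I f g : is_ideal I -> I f -> I g -> I (f - g).
Proof.
by case=> _ ID IM If Ig; apply: ID => //; rewrite -mulN1r; apply: IM.
Qed.

Lemma ideal_sum I (T : Type) (r : seq T) (P : pred T) (F : T -> R) :
  is_ideal I -> (forall i, P i -> I (F i)) -> I (\sum_(i <- r | P i) F i).
Proof. by case=> I0 ID _ IF; elim/big_ind: _. Qed.

End IdealTheory.

Lemma ideal_exprD (R : comNzRingType) (I : R -> Prop) (a b : R) k l : is_ideal I ->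
  I (a ^+ k) -> I (b ^+ l) -> I ((a + b) ^+ (k + l)).
Proof.
move=> idI Ia Ib; rewrite exprDn; apply: ideal_sum => // i _.
case: idI => _ ID IM; rewrite -mulr_natl; apply: (IM).
case: (leqP l i) => [le_l|lt_i].
  by rewrite -(subnK le_l) exprD mulrA; apply: IM.
rewrite mulrC (_ : (k + l - i = (l - i) + k)%N) ?exprD ?mulrA; last by lia.
exact: IM.
Qed.

Section IdealPowers.
Variable R : comNzRingType.
Implicit Types (S I L Q : R -> Prop) (f g h a b : R).

Lemma ideal_gen_ideal S : is_ideal (ideal_gen S).
Proof.
split=> [|_ _ [s [Hs ->]] [t [Ht ->]]|a _ [s [Hs ->]]].
- by exists [::]; rewrite big_nil.
- exists (s ++ t); rewrite big_cat; split=> // c.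
  by rewrite mem_cat => /orP [/Hs|/Ht].
- exists [seq (a * c.1, c.2) | c <- s]; split.
    by move=> _ /mapP [c /Hs Sc ->].
  by rewrite big_map mulr_sumr; apply: eq_bigr => c _; rewrite mulrA.
Qed.

Lemma ideal_gen_mem S f : S f -> ideal_gen S f.
Proof.
move=> Sf; exists [:: (1, f)]; rewrite big_seq1 mul1r; split=> // c.
by rewrite mem_seq1 => /eqP->.
Qed.

Lemma ideal_gen_min S I f :
  is_ideal I -> (forall g, S g -> I g) -> ideal_gen S f -> I f.
Proof.
move=> idI SI [s [Hs ->]]; rewrite big_seq; apply: ideal_sum => // c cs.
by case: idI => _ _ IM; apply: IM; apply: SI; apply: Hs.
Qed.

Lemma ideal_pow_ideal I m : is_ideal (ideal_pow I m).
Proof. exact: ideal_gen_ideal. Qed.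

Lemma ideal_pow0 I f : ideal_pow I 0 f.
Proof.
case: (ideal_pow_ideal I 0) => _ _ IM; rewrite -[f]mulr1; apply: IM.
apply: ideal_gen_mem; exists (fun=> 0); split; first by case.
by rewrite big_ord0.
Qed.

Lemma ideal_powS I m f g : I f -> ideal_pow I m g -> ideal_pow I m.+1 (f * g).
Proof.
have [P0 PD PM] := ideal_pow_ideal I m.+1.
move=> If; apply: (@ideal_gen_min _ (fun g => ideal_pow I m.+1 (f * g))).
  split=> [|g1 g2 H1 H2|a g1 H1]; first by rewrite mulr0.
    by rewrite mulrDr; apply: PD.
  by rewrite mulrCA; apply: PM.
move=> _ [t [It ->]]; apply: ideal_gen_mem.
exists (fun i => if unlift ord0 i is Some j then t j else f); split.
  by move=> i; case: unliftP.
rewrite big_ord_recl unlift_none; congr (_ * _).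
by apply: eq_bigr => i _; rewrite liftK.
Qed.

Lemma ideal_powM I m k f g :
  ideal_pow I m f -> ideal_pow I k g -> ideal_pow I (m + k) (f * g).
Proof.
have [P0 PD PM] := ideal_pow_ideal I (m + k).
move=> If Ig; apply: (ideal_gen_min (I := fun f => ideal_pow I (m + k) (f * g)) _ _ If).
  split=> [|g1 g2 H1 H2|c g1 H1]; first by rewrite mul0r.
    by rewrite mulrDl; apply: PD.
  by rewrite -mulrA; apply: PM.
move=> _ [t [It ->]] {P0 PD PM If f}; elim: m t It => [|m IH] t It.
  by rewrite big_ord0 mul1r.
by rewrite big_ord_recl -mulrA; apply: ideal_powS => //; apply: IH.
Qed.

Lemma ideal_pow_pred I m f : ideal_pow I m.+1 f -> ideal_pow I m f.
Proof.
apply: ideal_gen_min; first exact: ideal_pow_ideal.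
move=> _ [t [It ->]]; rewrite big_ord_recl.
case: (ideal_pow_ideal I m) => _ _ PM; apply/PM/ideal_gen_mem.
by exists (fun i => t (lift ord0 i)).
Qed.

Lemma ideal_pow_le I m k f : (k <= m)%N -> ideal_pow I m f -> ideal_pow I k f.
Proof.
move=> /subnK <-; elim: (m - k)%N => // j IH; rewrite addSn => /ideal_pow_pred.
exact: IH.
Qed.

Lemma ideal_powX I k f : I f -> ideal_pow I k (f ^+ k).
Proof.
move=> If; elim: k => [|k IH]; first exact: ideal_pow0.
by rewrite exprS; apply: ideal_powS.
Qed.

Lemma prime_expr Q a k : is_prime Q -> ~ Q a -> ~ Q (a ^+ k).
Proof.
case=> _ Q1 QM Qa; elim: k => [|k IH]; first by rewrite expr0.
by rewrite exprS => /QM [].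
Qed.

Lemma prime_mul Q a b : is_prime Q -> ~ Q a -> ~ Q b -> ~ Q (a * b).
Proof. by case=> _ _ QM Qa Qb /QM []. Qed.

(** The contraction to R of the extension of [L] to the localization at [Q], with denominators
    cleared; see [extended_idealP]. *)
Definition local_part L Q f : Prop := exists s, ~ Q s /\ L (s * f).

Lemma local_part_ideal L Q : is_ideal L -> is_prime Q -> is_ideal (local_part L Q).
Proof.
move=> [L0 LD LM] pQ; split=> [|f g [s [Qs Ls]] [t [Qt Lt]]|a f [s [Qs Ls]]].
- by exists 1; rewrite mulr0; split=> //; case: pQ.
- exists (s * t); split; first exact: prime_mul.
  rewrite mulrDr; apply: LD; first by rewrite [s * t]mulrC -mulrA; apply: LM.
  by rewrite -mulrA; apply: LM.
- by exists s; split=> //; rewrite mulrCA; apply: LM.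
Qed.

Lemma local_part_mem L Q f : is_prime Q -> L f -> local_part L Q f.
Proof. by move=> [_ Q1 _] Lf; exists 1; rewrite mul1r. Qed.

Lemma local_part_unit L Q s f : is_prime Q -> ~ Q s ->
  local_part L Q (s * f) -> local_part L Q f.
Proof.
move=> pQ Qs [t [Qt Lt]]; exists (t * s); split; first exact: prime_mul.
by rewrite -mulrA.
Qed.

Lemma local_powM I Q m k f g : is_prime Q ->
  local_part (ideal_pow I m) Q f -> local_part (ideal_pow I k) Q g ->
  local_part (ideal_pow I (m + k)) Q (f * g).
Proof.
move=> pQ [s [Qs Hs]] [t [Qt Ht]]; exists (s * t); split; first exact: prime_mul.
by rewrite mulrACA; apply: ideal_powM.
Qed.

Lemma local_powX I Q k f : is_prime Q ->
  local_part I Q f -> local_part (ideal_pow I k) Q (f ^+ k).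
Proof.
move=> pQ [s [Qs Ls]]; exists (s ^+ k); split; first exact: prime_expr.
by rewrite -exprMn; apply: ideal_powX.
Qed.

Lemma local_pow_le I Q m k f : (k <= m)%N ->
  local_part (ideal_pow I m) Q f -> local_part (ideal_pow I k) Q f.
Proof. by move=> le_k [s [Qs Ls]]; exists s; split=> //; apply: ideal_pow_le Ls. Qed.

Definition coefs_in L (p : {poly R}) : Prop := forall e, L p`_e.

Lemma coefs_in_ideal L : is_ideal L -> is_ideal (coefs_in L).
Proof.
move=> idL; have [L0 LD LM] := idL.
split=> [e|p q Lp Lq e|p q Lq e]; first by rewrite coef0.
  by rewrite coefD; apply: LD.
by rewrite coefM; apply: ideal_sum => // i _; apply: LM.
Qed.

(** Descending induction on the coefficients of [q]: in the coefficient of index n + j of [p * q],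
    the terms with q_b for b < j vanish, and those with b > j are already in [L] after
    multiplication by a power of the top coefficient of [p]. *)
Lemma top_coef_pow L (p q : {poly R}) n : is_ideal L -> (size p <= n.+1)%N ->
  coefs_in L (p * q) -> exists M, coefs_in L ((p`_n ^+ M)%:P * q).
Proof.
move=> idL le_p Lpq; have [L0 LD LM] := idL; set l := p`_n.
suff H i : forall j, (size q <= j + i)%N -> L (l ^+ i * q`_j).
  by exists (size q) => j; rewrite coefCM; apply: H; rewrite leq_addl.
elim: i => [|i IH] j le_q.
  by rewrite nth_default ?mulr0 //; rewrite addn0 in le_q.
have -> : l ^+ i.+1 * q`_j = l ^+ i * (p * q)`_(n + j) -
    l ^+ i * \sum_(b < (n + j).+1 | b != j :> nat) p`_(n + j - b) * q`_b.
  have lt_j : (j < (n + j).+1)%N by rewrite ltnS leq_addl.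
  rewrite -mulrBr coefMr (bigD1 (Ordinal lt_j)) //= addnK addrK.
  by rewrite exprSr mulrA.
apply: idealB => //; first exact: LM.
rewrite mulr_sumr; apply: ideal_sum => // b ne_b.
case: (ltnP b j) => [lt_b|le_b].
  rewrite [p`__]nth_default ?mul0r ?mulr0 //; apply: leq_trans le_p _; lia.
rewrite mulrCA; apply/LM/IH; lia.
Qed.

Lemma top_coef_powX L (p : {poly R}) n k : is_ideal L -> (size p <= n.+1)%N ->
  forall q, coefs_in L (p ^+ k * q) -> exists M, coefs_in L ((p`_n ^+ M)%:P * q).
Proof.
move=> idL le_p; elim: k => [|k IH] q Lq; first by exists 0%N.
move: Lq; rewrite exprS -mulrA => /(top_coef_pow idL le_p) [M1].
rewrite mulrCA => /IH [M2]; rewrite mulrA -polyCM -exprD.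
by exists (M2 + M1)%N.
Qed.

(* The content of p^k q is controlled by induction on p: either its top       *)
(* coefficient is outside Q, or it is nilpotent modulo the annihilator of q   *)
(* and can be dropped from p.                                                 *)
Lemma coefs_in_local L Q : is_ideal L -> is_prime Q ->
  forall (p q : {poly R}) k, coefs_in L (p ^+ k * q) -> ~ coefs_in Q p ->
  exists a, ~ Q a /\ coefs_in L (a%:P * q).
Proof.
move=> idL pQ p q k; have [n] := ubnP (size p).
elim: n p k => // n IH p k; rewrite ltnS; case: n IH => [|n] IH le_p Lpq Qp.
  case: Qp => e; rewrite nth_default ?(leq_trans le_p) //; by case: pQ => [[]].
have [M LM] := top_coef_powX idL le_p Lpq.
case: (classic (Q p`_n)) => [Qn|]; last first.
  by move=> Qn; exists (p`_n ^+ M); split=> //; apply: prime_expr.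
apply: (IH (take_poly n p) (k + M)%N); first by rewrite ltnS size_take_poly.
  have -> : take_poly n p = p + (- (p`_n)%:P) * 'X^n.
    apply/polyP => i; rewrite coef_take_poly coefD -polyCN coefCM coefXn.
    case: (ltngtP i n) => [_|lt_i|->]; rewrite ?mulr0 ?addr0 //.
      by rewrite nth_default // (leq_trans le_p).
    by rewrite mulr1 subrr.
  have [LX0 LXD LXM] := coefs_in_ideal idL.
  have idC : is_ideal (fun c : {poly R} => coefs_in L (c * q)).
    split=> [|c d Hc Hd|c d Hd]; first by rewrite mul0r.
      by rewrite mulrDl; apply: LXD.
    by rewrite -mulrA; apply: LXM.
  apply: (ideal_exprD idC) => //.
  rewrite exprMn [_ * 'X^n ^+ M]mulrC -mulrA; apply: (LXM).
  by rewrite exprNn -mulrA; apply: (LXM); rewrite -polyC_exp.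
move=> Qp'; apply: Qp => e; have := Qp' e; rewrite coef_take_poly.
have [[Q0 _ _] _ _] := pQ.
case: (ltngtP e n) => [//|lt_e _|-> _ //].
by rewrite nth_default // (leq_trans le_p).
Qed.

End IdealPowers.

Section FractionUnwinding.
Variable R : idomainType.
Implicit Types (L Q : R -> Prop) (f s : R).
Local Notation "x %:F" := (@FracField.tofrac R x).

Lemma extended_idealP L Q f : is_ideal L -> is_prime Q ->
  extended_ideal L Q f%:F <-> local_part L Q f.
Proof.
move=> idL pQ; have [L0 LD LM] := idL; have [[Q0 _ _] Q1 _] := pQ.
have nz s : ~ Q s -> s%:F != 0.
  by move=> Qs; rewrite tofrac_eq0; apply/eqP => s0; rewrite s0 in Qs.
split=> [[t [Ht fE]]|[s [Qs Ls]]]; last first.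
  exists [:: (s * f, s%:F^-1)]; split.
    move=> c; rewrite mem_seq1 => /eqP-> /=; split=> //; exists 1, s.
    by split=> //; rewrite tofrac1 mul1r.
  by rewrite big_seq1 /= tofracM mulrAC divff ?mul1r ?nz.
suff [s [h [Qs Lh E]]] : exists s h, [/\ ~ Q s, L h &
    \sum_(c <- t) c.1%:F * c.2 = h%:F / s%:F].
  exists s; split=> //; suff -> : s * f = h by [].
  apply/eqP; rewrite -tofrac_eq tofracM fE E mulrC divfK ?nz //.
elim: t Ht {fE} => [|c t IH] Ht.
  by exists 1, 0; rewrite big_nil tofrac0 mul0r.
have [d dt|s [h [Qs Lh E]]] := IH; first by apply: Ht; rewrite inE dt orbT.
have [Lc [a [r [Qr c2E]]]] := Ht c (mem_head _ _).
exists (r * s), (s * (a * c.1) + r * h); split; first exact: prime_mul.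
  by apply: LD; apply: (LM) => //; apply: LM.
rewrite big_cons E c2E tofracD !tofracM.
rewrite mulrA addf_div ?nz //; congr (_ / _); congr (_ + _); last exact: mulrC.
by rewrite mulrC [a%:F * _]mulrC.
Qed.

End FractionUnwinding.

(** * Gradedness of powers and of local parts *)

Section GradedIdeals.
Variables (k : nat) (K : fieldType).
Local Notation R := {mpoly K[k]}.
Implicit Types (I L Q : R -> Prop) (f : R).

Definition graded_pred L : Prop := forall f j, L f -> L (homog_part j f).

(** The substitution of T X_i for X_i. Its coefficients in T are the homogeneous components
    ([coef_spread]), so that grading arguments become arguments on polynomials over R. *)
Definition spread : R -> {poly R} :=
  mmap (polyC \o @mpolyC k K) (fun i => ('X_i : R)%:P * 'X).

HB.instance Definition _ := GRing.RMorphism.on spread.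

Lemma spreadX u : spread 'X_[u] = ('X_[u])%:P * 'X^(mdeg u).
Proof.
rewrite /spread mmapX /mmap1 mpolyXE_id rmorph_prod /= mdegE.
under eq_bigr => i _ do rewrite exprMn.
by rewrite big_split prodrXr; congr (_ * _); apply: eq_bigr => i _; rewrite rmorphXn.
Qed.

Lemma spreadZX c u : spread (c *: 'X_[u]) = (c *: 'X_[u])%:P * 'X^(mdeg u).
Proof.
rewrite -mul_mpolyC (rmorphM spread) /= spreadX polyCM -mulrA; congr (_ * _).
exact: mmapC.
Qed.

Lemma coef_spread f (e : nat) : (spread f)`_e = homog_part e%:Z f.
Proof.
rewrite [f]mpolyE (linear_sum (homog_part e%:Z)) (rmorph_sum spread) coef_sum.
apply: eq_bigr => u _; rewrite (linearZ_LR (homog_part e%:Z)) /= homog_partX.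
rewrite spreadZX coefCM coefXn eqz_nat eq_sym.
by case: eqP; rewrite ?mulr1 ?mulr0 ?scaler0.
Qed.

Lemma coefs_in_spread L f : L 0 -> coefs_in L (spread f) <-> forall j, L (homog_part j f).
Proof.
move=> L0; split=> [Lf [e|e]|Lf e]; rewrite -?coef_spread //; last first.
  by rewrite coef_spread.
by rewrite (_ : homog_part _ f = 0) //; apply/mpolyP => u; rewrite mcoeff_homog_part mcoeff0.
Qed.

Lemma spread1 f : (spread f).[1] = f.
Proof.
rewrite {1}[f]mpolyE (rmorph_sum spread) horner_sum [RHS]mpolyE.
apply: eq_bigr => u _; rewrite /= spreadZX hornerM hornerC hornerXn expr1n.
exact: mulr1.
Qed.

(** [Q] need not be homogeneous: since [s] is the value of [spread s] at 1, some coefficient of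
    [spread s] is outside [Q], and [coefs_in_local] turns [spread s * spread f] into one multiplier
    for all components of [f]. *)
Lemma graded_local L Q s f : is_ideal L -> graded_pred L -> is_prime Q ->
  ~ Q s -> L (s * f) -> exists a, ~ Q a /\ forall j, L (a * homog_part j f).
Proof.
move=> idL gL pQ Qs Lsf; have [L0 _ _] := idL.
have Lsp : coefs_in L (spread s ^+ 1 * spread f).
  by rewrite expr1 -rmorphM; apply/coefs_in_spread => // j; apply: gL.
have Qsp : ~ coefs_in Q (spread s).
  move=> Qsp; apply: Qs; rewrite -(spread1 s) horner_coef.
  have [idQ _ _] := pQ; apply: ideal_sum => // i _; rewrite mulrC.
  by case: idQ => _ _ QM; apply: QM.
have [a [Qa La]] := coefs_in_local idL pQ Lsp Qsp.
exists a; split=> //; apply/(@coefs_in_spread (fun h => L (a * h))).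
  by rewrite mulr0.
by move=> e; have := La e; rewrite coefCM.
Qed.

Lemma graded_gen (S : R -> Prop) :
    (forall g, S g -> forall j, ideal_gen S (homog_part j g)) ->
  graded_pred (ideal_gen S).
Proof.
move=> gS f j Sf; move: j; have idS := ideal_gen_ideal S; have [S0 _ _] := idS.
apply/coefs_in_spread => //.
have [C0 CD CM] := coefs_in_ideal idS.
apply: (ideal_gen_min (I := fun f => coefs_in (ideal_gen S) (spread f)) _ _ Sf).
  split=> [|g h Hg Hh|c g Hg].
  - by rewrite (rmorph0 spread).
  - rewrite (rmorphD spread); exact: CD Hg Hh.
  - rewrite (rmorphM spread); exact: CM Hg.
by move=> g Sg; apply/coefs_in_spread => //; apply: gS.
Qed.

Lemma graded_pow I m : is_ideal I -> graded_pred I -> graded_pred (ideal_pow I m).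
Proof.
move=> [I0 _ _] gI; apply: graded_gen => _ [t [It ->]].
have idP := ideal_pow_ideal I m; have [P0 PD PM] := idP.
apply/coefs_in_spread => //; rewrite rmorph_prod /=.
elim: m t It {idP P0 PD PM} => [|m IH] t It e; first exact: ideal_pow0.
rewrite big_ord_recl coefM; apply: ideal_sum (ideal_pow_ideal I _) _ => i _.
apply: ideal_powS; first by move: (nat_of_ord i); apply/coefs_in_spread => // j; apply: gI.
by apply: IH => l; apply: It.
Qed.

End GradedIdeals.

(** * The Fermat ideal *)

Section ModuloG.
Variables (R : comNzRingType) (J : R -> Prop).
Hypothesis idJ : is_ideal J.

Lemma ideal_congM u u' v v' : J (u - u') -> J (v - v') -> J (u * v - u' * v').
Proof.
case: idJ => _ JD JM Ju Jv.
have -> : u * v - u' * v' = v * (u - u') + u' * (v - v') by ring.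
by apply: JD; apply: JM.
Qed.

Lemma ideal_congX u u' k : J (u - u') -> J (u ^+ k - u' ^+ k).
Proof. by case: idJ => _ _ JM Ju; rewrite subrXX mulrC; apply: JM. Qed.

Lemma ideal_cong_mem u u' : J (u - u') -> J u -> J u'.
Proof. by move=> Juu' Ju; rewrite -[u'](subKr u); apply: idealB. Qed.

End ModuloG.

(** Halve [a], but never let [p] exceed [s]. The strict inequality [s < m] absorbs the rounding when
    [a] is odd. *)
Lemma balanced_split s m a : (s < m)%N -> (a <= m + s)%N ->
  exists p P, [/\ (p + P)%N = a, (p <= P <= m)%N, (p <= s)%N & (s - p <= m - P)%N].
Proof.
move=> lt_s le_a; have := odd_double_half a; rewrite -muln2.
set h := a./2; have : (odd a <= 1)%N by case: odd.
move: (nat_of_bool _) => o le_o aE.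
case: (leqP h s) => [le_h|lt_h].
  by exists h, (h + o)%N; split; [|apply/andP; split| |]; lia.
by exists s, (a - s)%N; split; [|apply/andP; split| |]; lia.
Qed.

(** Here [s] counts conics and [p] those with factor x^n. The product must have multiplicity [m] at
    all points, while its restriction modulo g, x^n to the power p + P times y^n to the power (s -
    p) + (m - P), must divide the target. *)
Lemma fat_point_exponents n m i j k a b :
    (2 <= n)%N -> (n <= m)%N -> (i < n)%N -> (j < n)%N -> (k < n)%N ->
    (m * n.+1 + n <= (n * (a + b) + i + j + k).+1)%N ->
  exists s p P, [/\ (p <= P <= m)%N, (p <= s)%N, (s - p <= m - P)%N,
    [/\ m <= n * s + i + j, m <= n * s + j + k & m <= n * s + i + k]%N
  & (p + P <= a)%N && ((s - p) + (m - P) <= b)%N].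
Proof.
move=> n_ge m_ge lt_i lt_j lt_k le_deg.
have mnE : (m * n.+1 = n * m + m)%N by rewrite mulnS mulnC addnC.
rewrite {}mnE in le_deg.
(* Otherwise the degree bound would give m <= n - 2; this uses n <= m. *)
have le_m : (m <= a + b)%N.
  rewrite leqNgt; apply/negP => lt_m.
  by have := leq_mul (leqnn n) lt_m; rewrite mulnS; lia.
have [s [lt_s le_s ns]] : exists s, [/\ (s < m)%N, (m + s <= a + b)%N
    & [/\ m <= n * s + i + j, m <= n * s + j + k & m <= n * s + i + k]%N].
  (* The largest possible [s] is a + b - m, capped at m - 1. In the first case the degree hypothesis
     gives the multiplicities exactly, as each residue is at most n - 1; in the second, n(m - 1) >=
     m. *)
  case: (ltnP (a + b - m) m) => [lt_s|le_s].
    exists (a + b - m)%N; split=> //; first by lia.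
    by rewrite mulnBr; split; lia.
  have : (m <= n * m.-1)%N.
    by have := leq_mul n_ge (leqnn m.-1); lia.
  by exists m.-1; split; [| |split]; lia.
have [a1 [le_a le_b le_a1]] : exists a1,
    [/\ (a1 <= a)%N, (m + s - a1 <= b)%N & (a1 <= m + s)%N].
  case: (leqP a (m + s)) => [le_a|lt_a]; first by exists a; split; lia.
  by exists (m + s)%N; split; lia.
have [p [P [pE pP1 pP2 pP3]]] := balanced_split lt_s le_a1.
by exists s, p, P; split=> //; apply/andP; split; move: pP1; lia.
Qed.

Section FatPoints.
Variables (R : comNzRingType) (x y z : R) (n m : nat).
Hypotheses (n_ge : (2 <= n)%N) (m_ge : (n <= m)%N).

(* With a = x^n, b = y^n, c = z^n, these are products of the conics a(c - b)   *)
(* and b(c - a) and of the lines c - b and c - a.                             *)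
Definition fat_point_elt i j k p P s : R :=
  x ^+ i * y ^+ j * z ^+ k * ((x ^+ n) ^+ p * (y ^+ n) ^+ (s - p) *
   (z ^+ n - y ^+ n) ^+ P * (z ^+ n - x ^+ n) ^+ (m - P)).

(** The first inequalities match every factor x^n or y^n with a line to form a conic. The last three
    ask for multiplicity [m] at [0:0:1], [1:0:0] and [0:1:0]. *)
Definition fat_point_cond i j k p P s : Prop :=
  [/\ (p <= P <= m)%N, (p <= s)%N, (s - p <= m - P)%N &
  [/\ m <= n * s + i + j, m <= n * s + j + k & m <= n * s + i + k]%N].

Variable J : R -> Prop.
Hypothesis idJ : is_ideal J.
Hypothesis J_elt : forall i j k p P s,
  fat_point_cond i j k p P s -> J (fat_point_elt i j k p P s).

Local Notation g := (x ^+ n + y ^+ n - z ^+ n).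

Definition plus_g (f : R) : Prop := exists u, J (f - g * u).

Lemma plus_g_ideal : is_ideal plus_g.
Proof.
have [J0 JD JM] := idJ.
split=> [|f h [u Ju] [v Jv]|a f [u Ju]].
- by exists 0; rewrite mulr0 subrr.
- exists (u + v); rewrite (_ : _ - _ = (f - g * u) + (h - g * v)); last by ring.
  exact: JD.
- exists (a * u); rewrite (_ : _ - _ = a * (f - g * u)); last by ring.
  exact: JM.
Qed.

Lemma plus_g_mem f : J f -> plus_g f.
Proof. by exists 0; rewrite mulr0 subr0. Qed.

Lemma plus_g_g u : plus_g (g * u).
Proof. by exists u; rewrite subrr; case: idJ. Qed.

(* Modulo g the lines z^n - y^n and z^n - x^n through [1:1:1] become x^n and  *)
(* y^n, so that the products of conics and lines restrict to all monomials.   *)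
Lemma plus_g_monomial2 i j k a b :
    (i < n)%N -> (j < n)%N -> (k < n)%N ->
    (m * n.+1 + n <= (n * (a + b) + i + j + k).+1)%N ->
  plus_g (x ^+ i * y ^+ j * z ^+ k * ((x ^+ n) ^+ a * (y ^+ n) ^+ b)).
Proof.
move=> lt_i lt_j lt_k le_deg.
have [s [p [P [pP1 pP2 pP3 ns /andP [le_a le_b]]]]] :=
  fat_point_exponents n_ge m_ge lt_i lt_j lt_k le_deg.
have Jelt := J_elt (And4 pP1 pP2 pP3 ns).
have idG := plus_g_ideal; have [_ _ GM] := idG.
have G1 : plus_g ((z ^+ n - y ^+ n) - x ^+ n).
  rewrite (_ : _ - _ = g * (-1)); last by ring.
  exact: plus_g_g.
have G2 : plus_g ((z ^+ n - x ^+ n) - y ^+ n).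
  rewrite (_ : _ - _ = g * (-1)); last by ring.
  exact: plus_g_g.
have E : plus_g (x ^+ i * y ^+ j * z ^+ k * ((x ^+ n) ^+ p * (y ^+ n) ^+ (s - p) *
   (x ^+ n) ^+ P * (y ^+ n) ^+ (m - P))).
  apply: (ideal_cong_mem idG) (plus_g_mem Jelt).
  have refl u : plus_g (u - u) by rewrite subrr; case: idG.
  by do !apply: ideal_congM => //; apply: ideal_congX.
have aE : a = (p + P + (a - (p + P)))%N by rewrite subnKC.
have bE : b = (s - p + (m - P) + (b - (s - p + (m - P))))%N by rewrite subnKC.
rewrite {1}aE {1}bE !exprD.
move: E; set a' := (a - _)%N; set b' := (b - _)%N.
move: (_ ^+ p) (_ ^+ P) (_ ^+ (s - p)) (_ ^+ (m - P)) => u1 u2 u3 u4 E.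
rewrite (_ : _ * _ = (x ^+ n) ^+ a' * (y ^+ n) ^+ b' *
  (x ^+ i * y ^+ j * z ^+ k * (u1 * u3 * u2 * u4))); first exact: GM.
move: (_ ^+ a') (_ ^+ b') (x ^+ i) (y ^+ j) (z ^+ k) => *; ring.
Qed.

(** Modulo g, z^n is x^n + y^n; expanding its power leaves monomials of the same degree covered by
    [plus_g_monomial2]. *)
Lemma plus_g_monomial A B C : (m * n.+1 + n <= (A + B + C).+1)%N ->
  plus_g (x ^+ A * y ^+ B * z ^+ C).
Proof.
move=> le_deg; have n_gt0 : (0 < n)%N by lia.
have idG := plus_g_ideal; have [_ _ GM] := idG.
pose c := (C %/ n)%N.
have zc : plus_g ((x ^+ n + y ^+ n) ^+ c - (z ^+ n) ^+ c).
  apply: (ideal_congX idG); rewrite -[_ - _]mulr1; exact: plus_g_g.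
have XE (u : R) D : u ^+ D = u ^+ (D %% n) * (u ^+ n) ^+ (D %/ n).
  by rewrite -exprM -exprD addnC mulnC -divn_eq.
rewrite (XE x A) (XE y B) (XE z C).
set i := (A %% n)%N; set j := (B %% n)%N; set k := (C %% n)%N.
set a := (A %/ n)%N; set b := (B %/ n)%N; rewrite -/c.
have lt_i : (i < n)%N by rewrite ltn_mod.
have lt_j : (j < n)%N by rewrite ltn_mod.
have lt_k : (k < n)%N by rewrite ltn_mod.
rewrite (_ : _ * _ * _ = x ^+ i * y ^+ j * z ^+ k *
  ((x ^+ n) ^+ a * (y ^+ n) ^+ b) * (z ^+ n) ^+ c); last first.
  by move: (x ^+ i) (y ^+ j) (z ^+ k) (_ ^+ a) (_ ^+ b) (_ ^+ c) => *; ring.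
have refl u : plus_g (u - u) by rewrite subrr; case: idG.
apply: (ideal_cong_mem idG (ideal_congM idG (refl _) zc)).
rewrite exprDn mulr_sumr; apply: ideal_sum => // l _.
have le_l : (l <= c)%N by rewrite -ltnS.
rewrite mulrnAr -mulr_natl; apply: (GM).
rewrite [X in plus_g X](_ : _ = x ^+ i * y ^+ j * z ^+ k *
   ((x ^+ n) ^+ (a + (c - l)) * (y ^+ n) ^+ (b + l))); last first.
  rewrite !exprD.
  by move: (x ^+ i) (y ^+ j) (z ^+ k) (_ ^+ a) (_ ^+ b) (_ ^+ l) (_ ^+ (c - l)) => *; ring.
apply: plus_g_monomial2 => //.
rewrite (_ : a + (c - l) + (b + l) = a + b + c)%N; last lia.
move: le_deg; rewrite {1}(divn_eq A n) {1}(divn_eq B n) {1}(divn_eq C n).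
by rewrite -/i -/j -/k -/a -/b -/c !mulnDr [(n * a)%N]mulnC [(n * b)%N]mulnC [(n * c)%N]mulnC; lia.
Qed.

End FatPoints.

(** * Local analysis at primes over the Fermat ideal *)

Section FermatPrimes.
Variables (R : comNzRingType) (x y z : R) (n : nat) (I Q : R -> Prop).
Hypotheses (n_gt0 : (0 < n)%N) (idI : is_ideal I) (pQ : is_prime Q).
Hypotheses (I1 : I (x * (y ^+ n - z ^+ n))) (I2 : I (y * (z ^+ n - x ^+ n)))
           (I3 : I (z * (x ^+ n - y ^+ n))).
Hypotheses (IQ : forall f, I f -> Q f) (Qxyz : ~ (Q x /\ Q y /\ Q z)).

Let idQ : is_ideal Q. Proof. by case: pQ. Qed.

Let QX a : Q a -> Q (a ^+ n).
Proof. by case: idQ => _ _ QM Qa; rewrite -(prednK n_gt0) exprSr; apply: QM. Qed.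

Let Q_diff a b : Q a -> ~ Q b -> ~ Q (b ^+ n - a ^+ n).
Proof.
move=> Qa Qb Qd; apply: (prime_expr (k := n) pQ Qb).
have [_ QD _] := idQ; rewrite -[b ^+ n](subrK (a ^+ n)).
by apply: QD => //; apply: QX.
Qed.

Let Q_diff' a b : Q a -> ~ Q b -> ~ Q (a ^+ n - b ^+ n).
Proof.
move=> Qa Qb Qd; apply: (Q_diff Qa Qb); rewrite -opprB -mulN1r.
by case: idQ => _ _; apply.
Qed.

(** In terms of x^n, y^n, z^n these are the points [1:1:1], [1:0:0], [0:1:0] and [0:0:1]. *)
Inductive fermat_prime_spec : Prop :=
  | FermatTriple of ~ Q x & ~ Q y & ~ Q z & Q (y ^+ n - z ^+ n)
  | FermatX of ~ Q x & Q y & Q z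
  | FermatY of Q x & ~ Q y & Q z
  | FermatZ of Q x & Q y & ~ Q z.

Lemma fermat_primeP : fermat_prime_spec.
Proof.
have [_ _ QM] := pQ.
case: (classic (Q x)) (classic (Q y)) (classic (Q z)) => Qx [] Qy [] Qz.
- by case: Qxyz.
- exact: FermatZ.
- exact: FermatY.
- by case: (QM _ _ (IQ I2)) => // /(Q_diff Qx Qz).
- exact: FermatX.
- by case: (QM _ _ (IQ I3)) => // /(Q_diff Qy Qx).
- by case: (QM _ _ (IQ I1)) => // /(Q_diff Qz Qy).
- by apply: FermatTriple => //; case: (QM _ _ (IQ I1)).
Qed.

(** In each case g is congruent modulo [Q], up to sign, to the n-th power of a variable outside
    [Q]. *)
Lemma fermat_g_notin : ~ Q (x ^+ n + y ^+ n - z ^+ n).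
Proof.
have [_ QD QM] := idQ.
have notin a b : ~ Q a -> Q b -> ~ Q (a ^+ n + b).
  move=> Qa Qb Qab; apply: (prime_expr (k := n) pQ Qa).
  by rewrite -[_ ^+ n](addrK b); apply: idealB.
case: fermat_primeP => [Qx _ _ Qyz|Qx Qy Qz|Qx Qy Qz|Qx Qy Qz].
- by rewrite -addrA; apply: notin.
- by rewrite -addrA; apply: notin => //; apply: idealB => //; apply: QX.
- rewrite [x ^+ n + _]addrC -addrA; apply: notin => //.
  by apply: idealB => //; apply: QX.
move=> Qg; apply: (notin z (- (x ^+ n + y ^+ n)) Qz).
  by rewrite -mulN1r; apply: (QM); apply: QD; apply: QX.
by rewrite -opprB -mulN1r; apply: QM.
Qed.

Let P k f := local_part (ideal_pow I k) Q f.

Let P_ideal k : is_ideal (P k).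
Proof. by apply: local_part_ideal => //; apply: ideal_pow_ideal. Qed.

Let PM k h f : P k f -> P k (h * f).
Proof. by case: (P_ideal k) => _ _; apply. Qed.

Let PX a b f : P a f -> P (a * b) (f ^+ b).
Proof.
move=> Pf; elim: b => [|b IH].
  by rewrite muln0; apply: local_part_mem => //; apply: ideal_pow0.
by rewrite mulnS exprS; apply: local_powM.
Qed.

Let PX1 b f : local_part I Q f -> P b (f ^+ b).
Proof. exact: local_powX. Qed.

(** Where no variable vanishes, both differences of n-th powers lie in the localized [I] and
    contribute q + (m - q). At a coordinate point the two vanishing variables lie in the localized
    [I], since their cofactors in the generators are units; counting them gives the inequalities of
    [fat_point_cond]. *)
Lemma fat_point_elt_local m i j k p q s : fat_point_cond n m i j k p q s ->
  P m (fat_point_elt x y z n m i j k p q s).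
Proof.
case=> /andP [le_pq le_qm] le_ps le_spm [ns1 ns2 ns3].
have nsE : (n * p + n * (s - p) = n * s)%N by rewrite -mulnDr subnKC.
have nq : (n * p <= n * q)%N by rewrite leq_mul2l le_pq orbT.
have nmq : (n * (s - p) <= n * (m - q))%N by rewrite leq_mul2l le_spm orbT.
have loc a h : ~ Q h -> I (a * h) -> local_part I Q a.
  by move=> Qh Iah; exists h; rewrite mulrC.
have Xn a b : local_part I Q a -> P (n * b) ((a ^+ n) ^+ b).
  by move=> La; apply/PX/PX1.
rewrite /fat_point_elt.
case: fermat_primeP => [Qx Qy Qz Qyz|Qx Qy Qz|Qx Qy Qz|Qx Qy Qz].
- have L1 : local_part I Q (z ^+ n - y ^+ n).
    exists x; split=> //; rewrite -opprB mulrN -mulN1r.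
    by case: idI => _ _; apply.
  have L2 : local_part I Q (z ^+ n - x ^+ n) by exists y.
  rewrite -!mulrA; do 5 apply: (PM).
  by have := local_powM pQ (PX1 q L1) (PX1 (m - q) L2); rewrite subnKC.
- have Ly : local_part I Q y by apply: loc I2; apply: Q_diff'.
  have Lz : local_part I Q z by apply: loc I3; apply: Q_diff.
  have LU : P n (z ^+ n - y ^+ n) by apply: (idealB (P_ideal n)); apply: PX1.
  have : P (j + k + (n * (s - p) + n * q))
     (y ^+ j * z ^+ k * ((y ^+ n) ^+ (s - p) * (z ^+ n - y ^+ n) ^+ q)).
    by do !apply: local_powM => //; by [apply: PX1|apply: Xn|apply: PX].
  move/local_pow_le => /(_ m) H.
  have {}H := PM (x ^+ i * (x ^+ n) ^+ p * (z ^+ n - x ^+ n) ^+ (m - q)) (H _).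
  rewrite [X in P m X](_ : _ = x ^+ i * (x ^+ n) ^+ p * (z ^+ n - x ^+ n) ^+ (m - q) *
    (y ^+ j * z ^+ k * ((y ^+ n) ^+ (s - p) * (z ^+ n - y ^+ n) ^+ q))).
    by apply: H; lia.
  move: (_ ^+ q) (_ ^+ (m - q)) (_ ^+ (s - p)) (_ ^+ p) (_ ^+ i) (_ ^+ j) (_ ^+ k).
  by move=> *; ring.
- have Lx : local_part I Q x by apply: loc I1; apply: Q_diff.
  have Lz : local_part I Q z by apply: loc I3; apply: Q_diff'.
  have LU : P n (z ^+ n - x ^+ n) by apply: (idealB (P_ideal n)); apply: PX1.
  have : P (i + k + (n * p + n * (m - q)))
     (x ^+ i * z ^+ k * ((x ^+ n) ^+ p * (z ^+ n - x ^+ n) ^+ (m - q))).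
    by do !apply: local_powM => //; by [apply: PX1|apply: Xn|apply: PX].
  move/local_pow_le => /(_ m) H.
  have {}H := PM (y ^+ j * (y ^+ n) ^+ (s - p) * (z ^+ n - y ^+ n) ^+ q) (H _).
  rewrite [X in P m X](_ : _ = y ^+ j * (y ^+ n) ^+ (s - p) * (z ^+ n - y ^+ n) ^+ q *
    (x ^+ i * z ^+ k * ((x ^+ n) ^+ p * (z ^+ n - x ^+ n) ^+ (m - q)))).
    by apply: H; lia.
  move: (_ ^+ q) (_ ^+ (m - q)) (_ ^+ (s - p)) (_ ^+ p) (_ ^+ i) (_ ^+ j) (_ ^+ k).
  by move=> *; ring.
- have Lx : local_part I Q x by apply: loc I1; apply: Q_diff'.
  have Ly : local_part I Q y by apply: loc I2; apply: Q_diff.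
  have : P (i + j + (n * p + n * (s - p)))
     (x ^+ i * y ^+ j * ((x ^+ n) ^+ p * (y ^+ n) ^+ (s - p))).
    by do !apply: local_powM => //; by [apply: PX1|apply: Xn|apply: PX].
  move/local_pow_le => /(_ m) H.
  have {}H := PM (z ^+ k * (z ^+ n - x ^+ n) ^+ (m - q) * (z ^+ n - y ^+ n) ^+ q) (H _).
  rewrite [X in P m X](_ : _ = z ^+ k * (z ^+ n - x ^+ n) ^+ (m - q) * (z ^+ n - y ^+ n) ^+ q *
    (x ^+ i * y ^+ j * ((x ^+ n) ^+ p * (y ^+ n) ^+ (s - p)))).
    by apply: H; lia.
  move: (_ ^+ q) (_ ^+ (m - q)) (_ ^+ (s - p)) (_ ^+ p) (_ ^+ i) (_ ^+ j) (_ ^+ k).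
  by move=> *; ring.
Qed.

End FermatPrimes.

(** * Monomials modulo the Fermat ideal, and its saturation *)

Section MonomialTransfer.
Variables (R : comNzRingType) (x y z : R) (n : nat) (I : R -> Prop).
Hypotheses (n_gt0 : (0 < n)%N) (idI : is_ideal I).
Hypotheses (I1 : I (x * (y ^+ n - z ^+ n))) (I2 : I (y * (z ^+ n - x ^+ n)))
           (I3 : I (z * (x ^+ n - y ^+ n))).

Definition mon3 i j k : R := x ^+ i * y ^+ j * z ^+ k.

Lemma mon3_mul1 i j k :
  mon3 i j k * (x * (y ^+ n - z ^+ n)) = mon3 i.+1 (j + n) k - mon3 i.+1 j (k + n).
Proof.
rewrite /mon3 !exprD !exprS.
by move: (_ ^+ n) (_ ^+ n) (_ ^+ i) (_ ^+ j) (_ ^+ k) => *; ring.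
Qed.

Lemma mon3_mul2 i j k :
  mon3 i j k * (y * (z ^+ n - x ^+ n)) = mon3 i j.+1 (k + n) - mon3 (i + n) j.+1 k.
Proof.
rewrite /mon3 !exprD !exprS.
by move: (_ ^+ n) (_ ^+ n) (_ ^+ i) (_ ^+ j) (_ ^+ k) => *; ring.
Qed.

Lemma mon3_mul3 i j k :
  mon3 i j k * (z * (x ^+ n - y ^+ n)) = mon3 (i + n) j k.+1 - mon3 i (j + n) k.+1.
Proof.
rewrite /mon3 !exprD !exprS.
by move: (_ ^+ n) (_ ^+ n) (_ ^+ i) (_ ^+ j) (_ ^+ k) => *; ring.
Qed.

Lemma mon3_mulz i j k : z * mon3 i j k = mon3 i j k.+1.
Proof. by rewrite /mon3 exprS mulrCA. Qed.

Definition mon3_cong i j k i' j' k' : Prop := I (mon3 i j k - mon3 i' j' k').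

Lemma mon3_cong_sym i j k i' j' k' :
  mon3_cong i j k i' j' k' -> mon3_cong i' j' k' i j k.
Proof.
by rewrite /mon3_cong => H; rewrite -opprB -mulN1r; case: idI => _ _; apply.
Qed.

Lemma mon3_cong_trans i j k i' j' k' i'' j'' k'' : mon3_cong i j k i' j' k' ->
  mon3_cong i' j' k' i'' j'' k'' -> mon3_cong i j k i'' j'' k''.
Proof.
rewrite /mon3_cong => Ia Ib; rewrite -[X in I X](subrKA (mon3 i' j' k')).
by case: idI => _ + _; apply.
Qed.

Let dvd (a b : R) q :
  exists h, a ^+ (n * q) - b ^+ (n * q) = (a ^+ n - b ^+ n) * h.
Proof. by rewrite !exprM subrXX; eexists. Qed.

Lemma mon3_transfer_yz i j k q :
  (0 < i)%N -> mon3_cong i (j + n * q) k i j (k + n * q).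
Proof.
case: i => // i _; rewrite /mon3_cong /mon3 !exprD exprS.
have [h hE] := dvd y z q.
rewrite [X in I X](_ : _ = (x ^+ i * y ^+ j * z ^+ k * h) * (x * (y ^+ n - z ^+ n))).
  by case: idI => _ _; apply.
rewrite (_ : _ - _ = x ^+ i * y ^+ j * z ^+ k * x * (y ^+ (n * q) - z ^+ (n * q))).
  by rewrite hE; move: (_ - _) (_ ^+ i) (_ ^+ j) (_ ^+ k) => *; ring.
by move: (_ ^+ _) (_ ^+ _) (_ ^+ i) (_ ^+ j) (_ ^+ k) => *; ring.
Qed.

Lemma mon3_transfer_xz i j k q :
  (0 < j)%N -> mon3_cong (i + n * q) j k i j (k + n * q).
Proof.
case: j => // j _; rewrite /mon3_cong /mon3 !exprD exprS.
have [h hE] := dvd z x q.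
rewrite [X in I X](_ : _ = (- (x ^+ i * y ^+ j * z ^+ k * h)) * (y * (z ^+ n - x ^+ n))).
  by case: idI => _ _; apply.
rewrite (_ : _ - _ = - (x ^+ i * y ^+ j * z ^+ k * y * (z ^+ (n * q) - x ^+ (n * q)))).
  by rewrite hE; move: (_ - _) (_ ^+ i) (_ ^+ j) (_ ^+ k) => *; ring.
by move: (_ ^+ _) (_ ^+ _) (_ ^+ i) (_ ^+ j) (_ ^+ k) => *; ring.
Qed.

Lemma mon3_transfer_xy i j k q :
  (0 < k)%N -> mon3_cong (i + n * q) j k i (j + n * q) k.
Proof.
case: k => // k _; rewrite /mon3_cong /mon3 !exprD exprS.
have [h hE] := dvd x y q.
rewrite [X in I X](_ : _ = (x ^+ i * y ^+ j * z ^+ k * h) * (z * (x ^+ n - y ^+ n))).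
  by case: idI => _ _; apply.
rewrite (_ : _ - _ = x ^+ i * y ^+ j * z ^+ k * z * (x ^+ (n * q) - y ^+ (n * q))).
  by rewrite hE; move: (_ - _) (_ ^+ i) (_ ^+ j) (_ ^+ k) => *; ring.
by move: (_ ^+ _) (_ ^+ _) (_ ^+ i) (_ ^+ j) (_ ^+ k) => *; ring.
Qed.

(** An n-th power moves between two variables only in the presence of the third. The order of the
    moves depends on which residue is positive, so that the third variable is always there. *)
Lemma mon3_normal_residue i0 j0 a b k :
    (0 < i0)%N || (0 < j0)%N ->
    (2 <= (0 < i0 + n * a) + (0 < j0 + n * b) + (0 < k))%N ->
  mon3_cong (i0 + n * a) (j0 + n * b) k i0 j0 (k + n * a + n * b).
Proof.
move=> ij0 good; case: (posnP i0) ij0 => [i00 /= j0p|i0p _]; last first.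
  apply: mon3_cong_trans (mon3_transfer_yz _ _ _ _) _; first by rewrite addn_gt0 i0p.
  rewrite -addnA [(n * a + _)%N]addnC addnA.
  case: (posnP j0) => [j00|j0p]; last exact: mon3_transfer_xz.
  apply: mon3_cong_trans (mon3_transfer_xy _ _ _ _) _.
    by move: good; rewrite j00 add0n addn_gt0; case: (posnP k) => //; lia.
  exact: mon3_transfer_yz.
apply: mon3_cong_trans (mon3_transfer_xz _ _ _ _) _; first by rewrite addn_gt0 j0p.
apply: mon3_cong_trans (mon3_cong_sym (mon3_transfer_xy _ _ _ _)) _.
  by move: good; rewrite i00 add0n addn_gt0; case: (posnP k) => //; lia.
exact: mon3_transfer_xz.
Qed.

(** With both residues zero, moving everything to z would leave a pure power, not congruent to the
    monomial; one factor y^n is kept instead. *)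
Lemma mon3_normal_0 a b k :
    (2 <= (0 < a) + (0 < b) + (0 < k))%N ->
  mon3_cong (0 + n * a) (0 + n * b) k 0 n (k + n * a + n * b - n).
Proof.
rewrite !add0n.
suff H c l : (0 < c)%N -> (0 < l)%N -> mon3_cong 0 (n * c) l 0 n (l + n * c - n).
  move=> good; case: (posnP b) => [b0|b_gt0].
    rewrite b0 muln0 addn0; have a_gt0 : (0 < a)%N by lia.
    have k_gt0 : (0 < k)%N by lia.
    apply: mon3_cong_trans (H a k a_gt0 k_gt0).
    by rewrite -[(n * a)%N in X in mon3_cong X]add0n; apply: mon3_transfer_xy.
  apply: mon3_cong_trans (H b _ b_gt0 _).
    rewrite -[(n * a)%N in X in mon3_cong X]add0n; apply: mon3_transfer_xz.
    by rewrite muln_gt0 n_gt0.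
  by rewrite addn_gt0 muln_gt0 n_gt0; lia.
case: c => // c _ l_gt0; rewrite mulnS addnCA addKn -[X in mon3_cong X]add0n.
apply: mon3_cong_trans (mon3_cong_sym (mon3_transfer_xy _ _ _ _)) _ => //.
exact: mon3_transfer_xz.
Qed.

End MonomialTransfer.

Section Saturated.
Variables (K : fieldType) (n : nat).
Hypothesis n_gt0 : (0 < n)%N.
Local Notation R := {mpoly K[3]}.
Local Notation i0 := (@Ordinal 3 0 isT).
Local Notation i1 := (@Ordinal 3 1 isT).
Local Notation i2 := (@Ordinal 3 2 isT).
Local Notation x := ('X_i0 : R).
Local Notation y := ('X_i1 : R).
Local Notation z := ('X_i2 : R).
Local Notation I := (fermat_ideal K n).

Lemma fermat_ideal_ideal : is_ideal I.
Proof. exact: ideal_gen_ideal. Qed.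

Lemma fermat_mem1 : I (x * (y ^+ n - z ^+ n)).
Proof. by apply: ideal_gen_mem; exact: mem_head. Qed.

Lemma fermat_mem2 : I (y * (z ^+ n - x ^+ n)).
Proof. by apply: ideal_gen_mem; rewrite in_cons mem_head orbT. Qed.

Lemma fermat_mem3 : I (z * (x ^+ n - y ^+ n)).
Proof. by apply: ideal_gen_mem; rewrite 2!in_cons mem_head !orbT. Qed.

Lemma fermat_ideal_min (L : R -> Prop) : is_ideal L ->
  L (x * (y ^+ n - z ^+ n)) -> L (y * (z ^+ n - x ^+ n)) ->
  L (z * (x ^+ n - y ^+ n)) -> forall f, I f -> L f.
Proof.
move=> idL L1 L2 L3 f; apply: ideal_gen_min => // h.
by rewrite !inE => /or3P [] /eqP ->.
Qed.

Definition mnm3 (i j k : nat) : 'X_{1..3} :=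
  (U_(i0) *+ i + U_(i1) *+ j + U_(i2) *+ k)%MM.

Lemma mnm3E i j k : [/\ mnm3 i j k i0 = i, mnm3 i j k i1 = j & mnm3 i j k i2 = k].
Proof.
by rewrite /mnm3 !mnmDE !mulmnE !mnm1E /= !mul1n !mul0n !addn0 !add0n.
Qed.

Lemma mnm3K (u : 'X_{1..3}) : mnm3 (u i0) (u i1) (u i2) = u.
Proof.
have [e0 e1 e2] := mnm3E (u i0) (u i1) (u i2).
apply/mnmP => -[[|[|[|//]]] lt_i].
- by rewrite (_ : Ordinal lt_i = i0) //; apply: val_inj.
- by rewrite (_ : Ordinal lt_i = i1) //; apply: val_inj.
- by rewrite (_ : Ordinal lt_i = i2) //; apply: val_inj.
Qed.

Lemma mpolyX3 i j k : 'X_[mnm3 i j k] = mon3 x y z i j k.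
Proof. by rewrite /mnm3 !mpolyXD -!mpolyXn. Qed.

(* Modulo I, a monomial in at least two variables depends only on its degree  *)
(* and on its exponents mod n; on R, residue_mon is reduction modulo          *)
(* (x^n - y^n, y^n - z^n), where z is regular.                                *)
Definition residue_mon (u : 'X_{1..3}) : R :=
  'X_[mnm3 (u i0 %% n) (u i1 %% n) (u i2 + n * (u i0 %/ n) + n * (u i1 %/ n))].

(** Sends a residue back to the normal form modulo [I]: a pure power of z stands for a monomial in
    which one factor y^n was kept. *)
Definition lift_mon (u : 'X_{1..3}) : R :=
  if (u i0 == 0%N) && (u i1 == 0%N) then 'X_[mnm3 0 n (u i2 - n)] else 'X_[u].

Lemma residue_mon3 i j k : mlin residue_mon (mon3 x y z i j k) =
  'X_[mnm3 (i %% n) (j %% n) (k + n * (i %/ n) + n * (j %/ n))].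
Proof.
by rewrite -mpolyX3 mlinX /residue_mon; have [-> -> ->] := mnm3E i j k.
Qed.

(** A monomial times a generator is a difference of two monomials with the same residue. *)
Lemma residue_fermat f : I f -> mlin residue_mon f = 0.
Proof.
move=> If; rewrite -[f]mul1r; move: 1.
have gen (h : R) : (forall i j k, mlin residue_mon (mon3 x y z i j k * h) = 0) ->
    forall c, mlin residue_mon (c * h) = 0.
  move=> H c; rewrite [c]mpolyE mulr_suml linear_sum big1 // => u _.
  by rewrite -scalerAl linearZ /= -(mnm3K u) mpolyX3 H scaler0.
have modD i : ((i + n) %% n = i %% n)%N by rewrite modnDr.
have divD i : (n * ((i + n) %/ n) = n + n * (i %/ n))%N.
  by rewrite divnDr ?dvdnn // divnn n_gt0 addn1 mulnS.
apply: (fermat_ideal_min (L := fun f => forall c, mlin residue_mon (c * f) = 0) _ _ _ _ If).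
- split=> [c|g h Hg Hh c|a g Hg c]; first by rewrite mulr0 linear0.
    by rewrite mulrDr linearD /= Hg Hh addr0.
  by rewrite mulrA.
- apply: gen => i j k; rewrite mon3_mul1 linearB /= !residue_mon3 modD divD.
  by apply/eqP; rewrite subr_eq0; apply/eqP; congr ('X_[mnm3 _ _ _]); lia.
- apply: gen => i j k; rewrite mon3_mul2 linearB /= !residue_mon3 modD divD.
  by apply/eqP; rewrite subr_eq0; apply/eqP; congr ('X_[mnm3 _ _ _]); lia.
- apply: gen => i j k; rewrite mon3_mul3 linearB /= !residue_mon3 !modD !divD.
  by apply/eqP; rewrite subr_eq0; apply/eqP; congr ('X_[mnm3 _ _ _]); lia.
Qed.

Lemma residue_mulz f : mlin residue_mon (z * f) = z * mlin residue_mon f.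
Proof.
rewrite [f]mpolyE mulr_sumr !linear_sum mulr_sumr; apply: eq_bigr => u _.
rewrite -scalerAr !linearZ /= -scalerAr -(mnm3K u) mpolyX3 mon3_mulz.
by rewrite !residue_mon3 !mpolyX3 mon3_mulz !addSn.
Qed.

(** [I] vanishes at the coordinate point where only ['X_c] is nonzero, that is, it lies in the ideal
    of the other two variables; so ['X_c * f] has no pure power of ['X_c]. *)
Lemma fermat_pure (a b c : 'I_3) f (u : 'X_{1..3}) :
    a != c -> b != c -> (forall i : 'I_3, [|| i == a, i == b | i == c]) ->
  I ('X_c * f) -> u a = 0%N -> u b = 0%N -> f@_u = 0.
Proof.
move=> ac bc abc Icf ua ub.
pose L (h : R) := exists p q : R, h = p * 'X_a + q * 'X_b.
have idL : is_ideal L.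
  split=> [|g h [p [q ->]] [p' [q' ->]]|d g [p [q ->]]].
  - by exists 0, 0; rewrite !mul0r addr0.
  - by exists (p + p'), (q + q'); rewrite !mulrDl addrACA.
  - by exists (d * p), (d * q); rewrite mulrDr !mulrA.
have [_ LD LM] := idL.
have La : L 'X_a by exists 1, 0; rewrite mul1r mul0r addr0.
have Lb : L 'X_b by exists 0, 1; rewrite mul1r mul0r add0r.
have LX i : i != c -> L ('X_i ^+ n).
  move=> ne; rewrite -(prednK n_gt0) exprSr; apply: LM.
  by have := abc i; rewrite (negbTE ne) orbF => /orP [] /eqP ->.
have gen i j k : i != j -> i != k -> L ('X_i * ('X_j ^+ n - 'X_k ^+ n)).
  move=> ij ik; case: (eqVneq i c) => [ic|ne]; last first.
    rewrite mulrC; apply: LM.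
    by have := abc i; rewrite (negbTE ne) orbF => /orP [] /eqP ->.
  by apply: (LM); apply: (idealB idL); apply: LX; rewrite -ic eq_sym.
have [p [q E]] : L ('X_c * f) by apply: (fermat_ideal_min idL _ _ _ Icf); apply: gen.
have noX (h : R) i (v : 'X_{1..3}) : v i = 0%N -> (h * 'X_i)@_v = 0.
  move=> vi; apply: memN_msupp_eq0; rewrite (perm_mem (msuppMX _ _)).
  by apply/mapP => -[w _ vE]; move: vi; rewrite vE mnmDE mnm1E eqxx.
have := congr1 (mcoeff (U_(c) + u)%MM) E.
rewrite mulrC [in LHS]mcoeffMX mcoeffD => ->.
by rewrite !noX ?addr0 // mnmDE mnm1E ?ua ?ub addn0 eq_sym; apply/eqP; rewrite eqb0.
Qed.

(** By [fermat_pure] every monomial of [f] involves two variables, hence is congruent to a normal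
    form that depends only on its residue. The residue of [f] is 0, because z is regular on
    residues; so the normal forms add up to 0. *)
Lemma fermat_saturated f : I (x * f) -> I (y * f) -> I (z * f) -> I f.
Proof.
move=> Ix Iy Iz; have idI := fermat_ideal_ideal; have [_ ID IM] := idI.
have ord3 (i : 'I_3) : [|| i == i0, i == i1 | i == i2] by case: i => -[|[|[|]]].
have rho0 : mlin residue_mon f = 0.
  apply/eqP; have /eqP := residue_fermat Iz; rewrite residue_mulz mulf_eq0.
  by rewrite -msupp_eq0 [msupp z]msuppX.
have good (u : 'X_{1..3}) : u \in msupp f ->
    (2 <= (0 < u i0) + (0 < u i1) + (0 < u i2))%N.
  rewrite mcoeff_msupp.
  case: (posnP (u i0)) => [u0|_]; case: (posnP (u i1)) => [u1|_];
    case: (posnP (u i2)) => [u2|_] //=; rewrite (_ : f@_u = 0) ?eqxx //.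
  - by apply: (@fermat_pure i0 i1 i2).
  - by apply: (@fermat_pure i0 i1 i2).
  - by apply: (@fermat_pure i0 i2 i1) => // i; have := ord3 i; rewrite [(i == i1) || _]orbC.
  - by apply: (@fermat_pure i1 i2 i0) => // i; have := ord3 i; rewrite orbC -orbA.
pose nf (u : 'X_{1..3}) := mlin lift_mon (residue_mon u).
have nfE : \sum_(u <- msupp f) f@_u *: nf u = 0.
  by rewrite -[LHS](mlin_comp lift_mon) rho0 linear0.
rewrite -[f]subr0 -nfE {1}[f]mpolyE -sumrB big_seq; apply: ideal_sum => // u uf.
rewrite -scalerBr -mul_mpolyC; apply: (IM).
rewrite /nf /residue_mon mlinX /lift_mon.
have [-> -> ->] := mnm3E (u i0 %% n) (u i1 %% n) (u i2 + n * (u i0 %/ n) + n * (u i1 %/ n)).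
have gu := good u uf; rewrite -{1}(mnm3K u) !mpolyX3.
have ui0 : u i0 = (u i0 %% n + n * (u i0 %/ n))%N by rewrite addnC mulnC -divn_eq.
have ui1 : u i1 = (u i1 %% n + n * (u i1 %/ n))%N by rewrite addnC mulnC -divn_eq.
move: (u i2) ui0 ui1 gu => k; move: (u i0 %% n)%N (u i0 %/ n)%N => r0 a0.
move: (u i1 %% n)%N (u i1 %/ n)%N => r1 a1 -> -> good_u.
case: ifP => [/andP [/eqP e0 /eqP e1]|ne].
  move: good_u; rewrite {}e0 {}e1 => good_u.
  apply: (@mon3_normal_0 _ x y z n I n_gt0 idI fermat_mem2 fermat_mem3).
  by move: good_u; rewrite !add0n !muln_gt0 n_gt0.
apply: (@mon3_normal_residue _ x y z n I n_gt0 idI fermat_mem1 fermat_mem2 fermat_mem3) => //.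
by rewrite !lt0n -negb_and ne.
Qed.

End Saturated.

(** * The line y = z and its points *)

Section LineRestriction.
Variables (K : fieldType) (n : nat).
Hypothesis n_gt0 : (0 < n)%N.
Local Notation R := {mpoly K[3]}.
Local Notation i0 := (@Ordinal 3 0 isT).
Local Notation i1 := (@Ordinal 3 1 isT).
Local Notation i2 := (@Ordinal 3 2 isT).
Local Notation x := ('X_i0 : R).
Local Notation y := ('X_i1 : R).
Local Notation z := ('X_i2 : R).
Local Notation I := (fermat_ideal K n).

(* The restriction f(1,t,t) of f to the line y = z. *)
Definition line : R -> {poly K} :=
  mmap polyC (fun i : 'I_3 => if i == i0 then 1 else 'X).

HB.instance Definition _ := GRing.RMorphism.on line.

(* The point [1:tau:tau], as the substitution f(x, tau x, tau x). *)
Definition at_point (tau : K) : R -> R :=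
  mmap (@mpolyC 3 K) (fun i : 'I_3 => if i == i0 then x else tau%:MP * x).

HB.instance Definition _ tau := GRing.RMorphism.on (at_point tau).

Lemma line_X i : line 'X_i = if i == i0 then 1 else 'X.
Proof. by rewrite /line mmapX mmap1U. Qed.

Lemma at_point_X tau i : at_point tau 'X_i = if i == i0 then x else tau%:MP * x.
Proof. by rewrite /at_point mmapX mmap1U. Qed.

Lemma line_mon c u : line (c *: 'X_[u]) = c *: 'X^(u i1 + u i2).
Proof.
rewrite /line mmapZ mmapX -mul_polyC; congr (_ * _).
rewrite /mmap1 !big_ord_recl big_ord0 /= expr1n mul1r mulr1 -exprD.
by congr ('X^(u _ + u _)); apply: val_inj.
Qed.

Lemma at_point_mon tau c u :
  at_point tau (c *: 'X_[u]) = (c * tau ^+ (u i1 + u i2))%:MP * x ^+ mdeg u.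
Proof.
rewrite /at_point mmapZ mmapX mpolyCM -mulrA; congr (_ * _).
rewrite /mmap1 !big_ord_recl big_ord0 /= mulr1 mdeg3E !exprMn.
rewrite (_ : ord0 = i0); last exact: val_inj.
rewrite (_ : lift i0 ord0 = i1); last exact: val_inj.
rewrite (_ : lift i0 (lift _ _) = i2); last exact: val_inj.
rewrite !exprD rmorphM !rmorphXn /=.
by move: (_ ^+ _) (_ ^+ _) (_ ^+ _) (_ ^+ _) (_ ^+ _) => *; ring.
Qed.

Lemma at_point_line tau (h : R) a : (forall u : 'X_{1..3}, u \in msupp h -> mdeg u = a) ->
  at_point tau h = ((line h).[tau])%:MP * x ^+ a.
Proof.
move=> ha; rewrite [h in LHS]mpolyE [h in RHS]mpolyE (rmorph_sum line).
rewrite (rmorph_sum (at_point tau)) horner_sum rmorph_sum mulr_suml !big_seq.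
apply: eq_bigr => u /ha <-; rewrite /= at_point_mon line_mon.
by rewrite hornerZ hornerXn.
Qed.

Lemma size_line (h : R) a : (forall u : 'X_{1..3}, u \in msupp h -> mdeg u = a) ->
  (size (line h) <= a.+1)%N.
Proof.
move=> ha; rewrite [h]mpolyE (rmorph_sum line) big_seq.
apply: (big_ind (fun p : {poly K} => size p <= a.+1)%N) => [|p q p_le q_le|u /ha ua /=].
- by rewrite size_poly0.
- by apply: leq_trans (size_polyD _ _) _; rewrite geq_max p_le.
rewrite line_mon.
apply: leq_trans (size_scale_leq _ _) _; rewrite size_polyXn ltnS -ua mdeg3E.
by rewrite -addnA leq_addl.
Qed.

Definition point_ideal tau (f : R) : Prop := at_point tau f = 0.

Lemma point_ideal_prime tau : is_prime (point_ideal tau).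
Proof.
rewrite /point_ideal; split; first split.
- exact: (rmorph0 (at_point tau)).
- move=> f g Hf Hg; rewrite (rmorphD (at_point tau)) /=.
  by rewrite [X in X + _]Hf [X in _ + X]Hg addr0.
- by move=> a f Hf; rewrite (rmorphM (at_point tau)) /= [X in _ * X]Hf mulr0.
- by rewrite (rmorph1 (at_point tau)); apply/eqP/oner_neq0.
- move=> f g; rewrite (rmorphM (at_point tau)) /= => /eqP.
  by rewrite mulf_eq0 => /orP [] /eqP H; [left|right].
Qed.

(** The equation tau^(n+1) = tau treats the point [1:0:0] and the roots of unity together. *)
Lemma fermat_point tau f : tau ^+ n.+1 = tau -> I f -> point_ideal tau f.
Proof.
move=> tauE; have [idQ _ _] := point_ideal_prime tau.
have E : tau%:MP ^+ n * tau%:MP = tau%:MP :> R.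
  by rewrite -exprSr -rmorphXn /= tauE.
have E' (a b : R) : tau%:MP * a * (tau%:MP ^+ n * b) = tau%:MP * a * b.
  by rewrite -[in RHS]E; move: (tau%:MP) (_ ^+ _) => *; ring.
apply: fermat_ideal_min => //; rewrite /point_ideal;
  rewrite !(rmorphM (at_point tau)) rmorphB !rmorphXn /= !at_point_X /= !exprMn.
- by rewrite subrr mulr0.
- by rewrite mulrBr E' subrr.
- by rewrite mulrBr E' subrr.
Qed.

(** The annihilator of [f0] modulo [I] contains y - tau x and z - tau x, so it contains every
    [g - at_point tau g], hence the point ideal. Conversely, [f0] does not vanish at the point,
    whereas [I] does. *)
Lemma point_associated tau (f0 : R) : tau ^+ n.+1 = tau ->
    I ((y - tau%:MP * x) * f0) -> I ((z - tau%:MP * x) * f0) ->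
    at_point tau f0 != 0 ->
  is_associated_prime I (point_ideal tau).
Proof.
move=> tauE Iy Iz nz; split; first exact: point_ideal_prime.
exists f0 => g; split; last first.
  move/(fermat_point tauE); rewrite /point_ideal (rmorphM (at_point tau)) /=.
  by move/eqP; rewrite mulf_eq0 (negbTE nz) orbF => /eqP.
pose L (h : R) := I (h * f0).
have idL : is_ideal L.
  have [I0 ID IM] := fermat_ideal_ideal K n; rewrite /L.
  split=> [|h h' Hh Hh'|a h Hh]; first by rewrite mul0r.
    by rewrite mulrDl; apply: ID.
  by rewrite -mulrA; apply: IM.
have [L0 LD LM] := idL.
have Lvar (i : 'I_3) : L ('X_i - at_point tau 'X_i).
  rewrite at_point_X; case: i => -[|[|[|//]]] lt_i.
  - by rewrite (_ : Ordinal lt_i = i0) ?subrr //; apply: val_inj.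
  - by rewrite (_ : Ordinal lt_i = i1) //; apply: val_inj.
  - by rewrite (_ : Ordinal lt_i = i2) //; apply: val_inj.
suff Lg : L (g - at_point tau g) by move=> g0; move: Lg; rewrite [X in _ - X]g0 subr0.
rewrite [g]mpolyE (rmorph_sum (at_point tau)) -sumrB; apply: ideal_sum => // u _ /=.
rewrite -mul_mpolyC (rmorphM (at_point tau)) /= {1}/at_point mmapC -mulrBr.
apply: (LM); rewrite mpolyXE_id rmorph_prod /=.
elim/big_rec2: _ => [|i a b _ Lab]; first by rewrite subrr.
by apply: ideal_congM => //; rewrite rmorphXn; apply: ideal_congX.
Qed.

End LineRestriction.

(** * Symbolic powers of the Fermat ideal *)

Lemma dvdp_prod_XsubC_exp (F : fieldType) (rs : seq F) (p : {poly F}) m :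
    uniq rs -> (forall r, r \in rs -> ('X - r%:P) ^+ m %| p) ->
  (\prod_(r <- rs) ('X - r%:P)) ^+ m %| p.
Proof.
elim: rs => [|r rs IH] /= => [_ _|/andP [r_rs rs_uniq] H].
  by rewrite big_nil expr1n dvd1p.
rewrite big_cons exprMn Gauss_dvdp ?H ?mem_head //=.
  by apply: IH => // r' r'rs; apply: H; rewrite inE r'rs orbT.
apply/coprimep_expl/coprimep_expr; rewrite coprimep_sym coprimep_XsubC.
by rewrite root_prod_XsubC.
Qed.

Section FermatSymbolicPowers.
Variables (K : fieldType) (n : nat).
Hypothesis n_gt0 : (0 < n)%N.
Local Notation R := {mpoly K[3]}.
Local Notation i0 := (@Ordinal 3 0 isT).
Local Notation i1 := (@Ordinal 3 1 isT).
Local Notation i2 := (@Ordinal 3 2 isT).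
Local Notation x := ('X_i0 : R).
Local Notation y := ('X_i1 : R).
Local Notation z := ('X_i2 : R).
Local Notation I := (fermat_ideal K n).

Lemma X_neq0 i : 'X_i != 0 :> R.
Proof. by rewrite -msupp_eq0 msuppX. Qed.

Lemma at_pointC (tau c : K) : at_point tau c%:MP = c%:MP.
Proof. exact: mmapC. Qed.

Lemma zero_associated : is_associated_prime I (point_ideal (0 : K)).
Proof.
have [_ _ IM] := fermat_ideal_ideal K n.
apply: (@point_associated K n _ ((z ^+ n - x ^+ n) * (x ^+ n - y ^+ n))).
- by rewrite expr0n.
- by rewrite mpolyC0 mul0r subr0 mulrA mulrC; apply: (IM); apply: fermat_mem2.
- by rewrite mpolyC0 mul0r subr0 mulrCA; apply: (IM); apply: fermat_mem3.
rewrite (rmorphM (at_point 0)) !rmorphB !rmorphXn /= !at_point_X /= mpolyC0 mul0r.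
by rewrite expr0n (gtn_eqF n_gt0) sub0r subr0 mulNr oppr_eq0 mulf_neq0 ?expf_neq0 ?X_neq0.
Qed.

Section RootOfUnity.
Variable tau : K.
Hypotheses (n_neq0 : n%:R != 0 :> K) (tau_n : tau ^+ n = 1).
Local Notation T := (tau%:MP * x).

Let tau_neq0 : tau != 0.
Proof.
apply/eqP => tau0; move: tau_n; rewrite tau0 expr0n (gtn_eqF n_gt0) => /eqP.
by rewrite eq_sym oner_eq0.
Qed.

(** The quotient of v^n - x^n by v - tau x. At v = tau x its value is n (tau x)^(n-1), nonzero
    because n is nonzero in K. *)
Let quo (v : R) := \sum_(i < n) v ^+ (n.-1 - i) * T ^+ i.

Let quoE v : (v - T) * quo v = v ^+ n - x ^+ n.
Proof.
rewrite -[X in _ = _ - X]mul1r -[1 in RHS](rmorph1 (@mpolyC 3 K)) -tau_n.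
by rewrite rmorphXn -exprMn subrXX.
Qed.

Let at_quo v : at_point tau v = T -> at_point tau (quo v) != 0.
Proof.
move=> vT; have aT : at_point tau T = T.
  by rewrite (rmorphM (at_point tau)) /= at_pointC at_point_X.
have -> : at_point tau (quo v) = T ^+ n.-1 *+ n.
  rewrite (rmorph_sum (at_point tau)) (eq_bigr (fun=> T ^+ n.-1)).
    by rewrite sumr_const card_ord.
  move=> i _; rewrite rmorphM !rmorphXn /= vT aT -exprD subnK //.
  by rewrite -ltnS (prednK n_gt0).
rewrite -mulr_natl mulf_neq0 //.
  by rewrite -(rmorph_nat (@mpolyC 3 K)) mpolyC_eq0.
by rewrite expf_neq0 // mulf_neq0 ?X_neq0 // mpolyC_eq0.
Qed.

(** The witness is xyz times both quotients: multiplying by y - tau x or z - tau x completes a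
    generator of [I]. *)
Lemma root_associated : is_associated_prime I (point_ideal tau).
Proof.
have [_ _ IM] := fermat_ideal_ideal K n.
have swap (a b c d e v : R) : v * (a * b * c * d * e) = a * b * e * (c * (v * d)).
  by ring.
have swap' (a b c d e v : R) : v * (a * b * c * d * e) = a * c * d * (b * (v * e)).
  by ring.
apply: (@point_associated K n _ (x * y * z * quo y * quo z)).
- by rewrite exprSr tau_n mul1r.
- rewrite swap quoE -opprB mulrN mulrN -mulNr; apply: (IM); exact: fermat_mem3.
- rewrite swap' quoE; apply: (IM); exact: fermat_mem2.
have T0 : T != 0 by rewrite mulf_neq0 ?X_neq0 // mpolyC_eq0.
rewrite !(rmorphM (at_point tau)) /= !mulf_neq0 ?at_quo ?at_point_X //=.
exact: X_neq0.
Qed.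
End RootOfUnity.
End FermatSymbolicPowers.

(** * Regularity of the symbolic powers *)

Section FermatRegularity.
Variables (K : fieldType) (n m : nat).
Hypothesis n_gt0 : (0 < n)%N.
Local Notation R := {mpoly K[3]}.
Local Notation i0 := (@Ordinal 3 0 isT).
Local Notation i1 := (@Ordinal 3 1 isT).
Local Notation i2 := (@Ordinal 3 2 isT).
Local Notation x := ('X_i0 : R).
Local Notation y := ('X_i1 : R).
Local Notation z := ('X_i2 : R).
Local Notation I := (fermat_ideal K n).
Local Notation J := (symbolic_power I m).

Lemma fermat_symbolicP (f : R) : J f <->
  forall Q, is_associated_prime I Q -> local_part (ideal_pow I m) Q f.
Proof.
split=> Jf Q aQ; have [pQ _] := aQ;
  have E := extended_idealP f (ideal_pow_ideal I m) pQ.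
  by apply/E; apply: Jf.
by apply/E; apply: Jf.
Qed.

Lemma fermat_assocP Q : is_associated_prime I Q ->
  [/\ is_prime Q, forall f, I f -> Q f & ~ (Q x /\ Q y /\ Q z)].
Proof.
move=> [pQ [f0 Qf0]]; have [_ _ IM] := fermat_ideal_ideal K n.
split=> // [f If|[/Qf0 Ix [/Qf0 Iy /Qf0 Iz]]].
  by apply/Qf0; rewrite mulrC; apply: IM.
have [_ Q1 _] := pQ; apply: Q1; apply/Qf0; rewrite mul1r.
exact: (fermat_saturated n_gt0 Ix Iy Iz).
Qed.

Lemma symbolic_ideal : is_ideal J.
Proof.
have idL Q (pQ : is_prime Q) := local_part_ideal (ideal_pow_ideal I m) pQ.
split=> [|f h /fermat_symbolicP Jf /fermat_symbolicP Jh|a f /fermat_symbolicP Jf];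
  apply/fermat_symbolicP => Q aQ; have [pQ _] := aQ; have [L0 LD LM] := idL Q pQ.
- exact: L0.
- by apply: LD; [apply: Jf | apply: Jh].
- by apply: LM; apply: Jf.
Qed.

Lemma fermat_pow_graded : graded_pred (ideal_pow I m).
Proof.
apply: graded_pow; first exact: fermat_ideal_ideal.
apply: graded_gen => f fS j.
have [a fa] : exists a : int, forall u : 'X_{1..3}, u \in msupp f -> (mdeg u)%:Z = a.
  exists n.+1%:Z => u; have hom (a b c : 'I_3) :
      u \in msupp ('X_a * ('X_b ^+ n - 'X_c ^+ n) : R) -> (mdeg u)%:Z = n.+1%:Z.
    case/msuppM_le/allpairsP => -[v w] /= [+ + ->]; rewrite msuppX mem_seq1.
    move=> /eqP-> /msuppB_le; rewrite mem_cat !mpolyXn !msuppX !mem_seq1 mdegD mdeg1.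
    by case/orP => /eqP->; rewrite mdegMn mdeg1 mul1n.
  by move: fS; rewrite !inE => /or3P [] /eqP ->; apply: hom.
rewrite -[f]mul1r (homog_partM _ _ fa).
have [_ _ IM] := fermat_ideal_ideal K n; apply: IM; exact: ideal_gen_mem.
Qed.

Lemma symbolic_graded : graded_pred J.
Proof.
move=> f j /fermat_symbolicP Jf; apply/fermat_symbolicP => Q aQ.
have [pQ _] := aQ; have [s [Qs Ls]] := Jf Q aQ.
have [a [Qa La]] := graded_local (ideal_pow_ideal I m) fermat_pow_graded pQ Qs Ls.
by exists a.
Qed.

Lemma symbolic_nzd f : J ((x ^+ n + y ^+ n - z ^+ n) * f) -> J f.
Proof.
move=> /fermat_symbolicP Jf; apply/fermat_symbolicP => Q aQ.
have [pQ IQ Qxyz] := fermat_assocP aQ.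
apply: (local_part_unit pQ _ (Jf Q aQ)).
exact: (fermat_g_notin n_gt0 pQ (fermat_mem1 K n) (fermat_mem2 K n) (fermat_mem3 K n) IQ Qxyz).
Qed.

Lemma symbolic_fat_point_elt i j k p q s : fat_point_cond n m i j k p q s ->
  J (fat_point_elt x y z n m i j k p q s).
Proof.
move=> cond; apply/fermat_symbolicP => Q aQ.
have [pQ IQ Qxyz] := fermat_assocP aQ.
exact: (fat_point_elt_local n_gt0 (fermat_ideal_ideal K n) pQ (fermat_mem1 K n)
  (fermat_mem2 K n) (fermat_mem3 K n) IQ Qxyz cond).
Qed.

Lemma symbolic_onto (h : R) : (2 <= n)%N -> (n <= m)%N ->
    order_ge (m * (n + 1) + n.-1) h ->
  exists u, J (h - (x ^+ n + y ^+ n - z ^+ n) * u).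
Proof.
move=> n_ge m_ge h_ge.
have [_ _ GM] := plus_g_ideal x y z n symbolic_ideal.
rewrite [h]mpolyE big_seq; apply: (ideal_sum _ (plus_g_ideal x y z n symbolic_ideal)).
move=> u /h_ge le_u; rewrite -mul_mpolyC; apply: GM; rewrite -(mnm3K u) mpolyX3.
apply: (plus_g_monomial n_ge m_ge symbolic_ideal symbolic_fat_point_elt).
rewrite -mdeg3E; move: le_u; rewrite addn1; lia.
Qed.

Lemma symbolic_koszul_regular : (2 <= n)%N -> (n <= m)%N ->
  koszul_regular [:: 0 : int] (m * (n + 1))%N%:Z (fun v => J (v 0 0)).
Proof.
move=> n_ge m_ge.
(* The cofactors have order n - 1, which is the [e] of the criterion; [d] is m(n+1). *)
have gE : x ^+ n + y ^+ n - z ^+ n = x * x ^+ n.-1 + y * y ^+ n.-1 + z * - z ^+ n.-1.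
  by rewrite mulrN -!exprS prednK.
have oX (i : 'I_3) : order_ge n.-1 ('X_i ^+ n.-1 : R).
  by move=> u; rewrite mpolyXn msuppX mem_seq1 => /eqP->; rewrite mdegMn mdeg1 mul1n.
apply: (@koszul_regular_criterion _ J (m * (n + 1)) n.-1 (x ^+ n.-1) (y ^+ n.-1) (- z ^+ n.-1)).
- exact: symbolic_ideal.
- by rewrite muln_gt0 addn1 (leq_trans _ m_ge).
- exact: oX.
- exact: oX.
- exact/order_geN/oX.
- by move=> f; rewrite -gE; apply: symbolic_nzd.
- by move=> h h_ge; rewrite -gE; apply: symbolic_onto.
Qed.

(** * Lower bound by restriction to the line y = z *)

Section LineVanishing.
Variable rs : seq K.
Hypotheses (rs_uniq : uniq rs) (rs_size : size rs = n.+1).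
Hypothesis rs_assoc : forall r, r \in rs ->
  r ^+ n.+1 = r /\ is_associated_prime I (point_ideal r).

Lemma fermat_line r f : r ^+ n.+1 = r -> I f -> 'X - r%:P %| line f.
Proof.
move=> rE; apply: (fermat_ideal_min (L := fun f => 'X - r%:P %| line f)).
- split=> [|g h Hg Hh|a g Hg]; first by rewrite (rmorph0 (@line K)) dvdp0.
    by rewrite (rmorphD (@line K)) dvdp_add.
  by rewrite (rmorphM (@line K)) dvdp_mull.
- by rewrite (rmorphM (@line K)) rmorphB !rmorphXn /= !line_X /= subrr mulr0 dvdp0.
- rewrite (rmorphM (@line K)) rmorphB !rmorphXn /= !line_X /= expr1n dvdp_XsubCl.
  by rewrite rootE !hornerE mulrBr mulr1 -exprS rE subrr.
- rewrite (rmorphM (@line K)) rmorphB !rmorphXn /= !line_X /= expr1n dvdp_XsubCl.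
  by rewrite rootE !hornerE mulrBr mulr1 -exprS rE subrr.
Qed.

Lemma fermat_pow_line r f : r ^+ n.+1 = r -> ideal_pow I m f ->
  ('X - r%:P) ^+ m %| line f.
Proof.
move=> rE; apply: (ideal_gen_min (I := fun f => ('X - r%:P) ^+ m %| line f)).
  split=> [|g h Hg Hh|a g Hg]; first by rewrite (rmorph0 (@line K)) dvdp0.
    by rewrite (rmorphD (@line K)) dvdp_add.
  by rewrite (rmorphM (@line K)) dvdp_mull.
move=> _ [t [It ->]]; rewrite (rmorph_prod (@line K)) /=.
rewrite -[m in _ ^+ m]card_ord -prodr_const.
elim/big_ind2: _ => [|p1 p2 q1 q2|i _]; [exact: dvd1p|exact: dvdp_mul|].
exact: fermat_line.
Qed.

(** Bezout on the line: [n.+1] distinct roots of multiplicity at least [m] exceed the degree [e]. *)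
Lemma line_vanishes (f : R) e : (forall u : 'X_{1..3}, u \in msupp f -> mdeg u = e) ->
  (e < m * n.+1)%N -> J f -> line f = 0.
Proof.
move=> fe lt_e /fermat_symbolicP Jf; apply/eqP/contraT => nz.
have div r : r \in rs -> ('X - r%:P) ^+ m %| line f.
  case/rs_assoc => rE /[dup] -[pQ _] /Jf [s [Qs Ls]].
  (* The denominator [s] may be inhomogeneous, and then its restriction to the line could vanish at
     [r]. A component outside the point ideal restricts to a polynomial prime to X - r. *)
  have [a Qa] : exists a : nat, ~ point_ideal r (homog_part a%:Z s).
    apply/not_all_ex_not => Qa; apply: Qs; rewrite -(spread1 s) horner_coef.
    have [idQ _ _] := pQ; have [_ _ QM] := idQ; apply: ideal_sum => // i _.
    by rewrite coef_spread mulrC; apply: QM.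
  have La : ideal_pow I m (homog_part a%:Z s * f).
    have fe' (u : 'X_{1..3}) : u \in msupp f -> (mdeg u)%:Z = e%:Z by move=> /fe ->.
    have := fermat_pow_graded (a%:Z + e%:Z) Ls.
    by rewrite (homog_partM _ _ fe') addrK.
  have := fermat_pow_line rE La; rewrite (rmorphM (@line K)) Gauss_dvdpr //.
  apply/coprimep_expl; rewrite coprimep_sym coprimep_XsubC; apply/negP => rt.
  apply: Qa; rewrite /point_ideal (@at_point_line _ r _ a).
    by move/rootP: rt => /= ->; rewrite mpolyC0 mul0r.
  by move=> u /homog_part_deg [].
have := dvdp_leq nz (dvdp_prod_XsubC_exp rs_uniq div).
rewrite leqNgt (leq_ltn_trans (size_line fe)) //.
rewrite polySpred ?expf_neq0 ?monic_neq0 ?monic_prod_XsubC //.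
by rewrite size_exp size_prod_XsubC rs_size ltnS mulnC.
Qed.
(** If all generators had smaller degree, all of [J] would vanish on the line; but (y(z^n - x^n))^m
    restricts to (t(t^n - 1))^m. *)
Lemma not_generated_below (a : seq int) (A : 'M[R]_(size a, size [:: 0 : int])) :
    graded_mx A -> (forall f, J f <-> exists v : 'rV_(size a), f = (v *m A) 0 0) ->
  exists2 j, j \in a & (m * (n + 1))%N%:Z <= j.
Proof.
move=> gA imA; apply/hasP/contraT => /hasPn below.
have line0 i : line (A i 0) = 0.
  have JA : J (A i 0).
    by apply/imA; exists (delta_mx 0 i); rewrite -rowE mxE.
  have lt_i : a`_i < (m * (n + 1))%N%:Z.
    by rewrite ltNge; apply: below; apply: mem_nth.
  (* A zero entry says nothing about its shift, which may even be negative; it is treated apart. *)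
  case E : (msupp (A i 0)) => [|u0 t].
    by move/eqP: E; rewrite msupp_eq0 => /eqP->; rewrite (rmorph0 (@line K)).
  have hA (u : 'X_{1..3}) : u \in msupp (A i 0) -> (mdeg u)%:Z = a`_i.
    by move/gA=> ->; rewrite subr0.
  apply: (@line_vanishes _ (absz (a`_i)%R)) => [u /hA <- //||//].
  have := hA u0; rewrite E mem_head => /(_ isT) e0.
  by move: lt_i; rewrite -e0 addn1; lia.
have Jf2 : J ((y * (z ^+ n - x ^+ n)) ^+ m).
  apply/fermat_symbolicP => Q [pQ _]; apply: local_part_mem => //.
  by apply: ideal_powX; apply: fermat_mem2.
have [v /(congr1 (@line K))] := (imA _).1 Jf2.
rewrite mxE (rmorph_sum (@line K)) big1 => [|i _]; last first.
  by rewrite (rmorphM (@line K)) /= line0 mulr0.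
move/eqP; rewrite (rmorphXn (@line K)) (rmorphM (@line K)) rmorphB !rmorphXn /= !line_X /=.
rewrite expf_eq0 mulf_eq0 polyX_eq0 expr1n /= -size_poly_eq0 size_XnsubC //.
by rewrite andbF.
Qed.

End LineVanishing.
End FermatRegularity.

Theorem theorem3p10 (n : nat) (hn : (3 <= n)%N) (K : fieldType)
    (hK : exists s : seq K,
       [/\ uniq s, size s = n & all (n.-unity_root) s]) :
  exists m0 : nat, forall m : nat, (m0 <= m)%N ->
    has_regularity (symbolic_power (fermat_ideal K n) m) (m * (n + 1))%N%:Z.
Proof.
have n_gt0 : (0 < n)%N by apply: leq_trans hn.
have [s [s_uniq s_size s_root]] := hK.
(* Having n distinct n-th roots of 1 forces a primitive one, so the characteristic does not divide
   n. *)
have n_neq0 : n%:R != 0 :> K.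
  have /hasP [w _ /prim_root_natf_neq0 //] :
    has n.-primitive_root s by rewrite has_prim_root ?s_size.
have sP r : r \in s -> r ^+ n = 1 by move/(allP s_root)/unity_rootP.
exists n => m m_ge; have n_ge : (2 <= n)%N by apply: leq_trans hn.
have [F F_le] := regular_resolution (symbolic_ideal K n m) (@symbolic_graded K n m)
  (@symbolic_koszul_regular K n m n_gt0 n_ge m_ge).
exists F; split; last first.
  move=> p j; rewrite /graded_betti -lt0n -has_count => /hasP [c /F_le le_c /eqP <-].
  by rewrite lerBlDr.
have rs_uniq : uniq (0 :: s).
  rewrite /= s_uniq andbT; apply/negP => /sP /eqP.
  by rewrite expr0n (gtn_eqF n_gt0) eq_sym oner_eq0.
have rs_assoc r : r \in 0 :: s ->
    r ^+ n.+1 = r /\ is_associated_prime (fermat_ideal K n) (point_ideal r).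
  rewrite inE => /orP [/eqP-> | /sP r_n].
    by split; [rewrite expr0n | apply: zero_associated].
  by split; [rewrite exprSr r_n mul1r | apply: root_associated].
have [|j jF le_j] := not_generated_below n_gt0 rs_uniq _ rs_assoc
  (@augmentation_graded _ _ _ F) (@augmentation_image _ _ _ F); first by rewrite /= s_size.
(* The maximum is attained at a generator: the lower bound for its degree meets the upper bound on
   the shifts for p = 0. *)
exists 0%N, j; rewrite subr0; split.
  by rewrite /graded_betti -lt0n -has_count has_pred1.
by apply/eqP; rewrite eq_le le_j andbT -[leRHS]addr0; apply: F_le.
Qed.
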